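(* Let $p\ge 2$ and let an explicit $s$-stage Runge--Kutta scheme with non-negative Butcher array $(\mathbf A,\mathbf b,\mathbf c)$ be of order $p$ and be equipped with a Runge--Kutta dense output formula, given by functions $\bar b_j\colon[0,1]\to\mathbb R$, $j=1,\dots,s$, of order $p^*=p-1$. Consider a positive and conservative production-destruction system with terms $p_{k\nu},d_{k\nu}\in\mathcal C^{p+1}$. Let the corresponding MPRK scheme (with Patankar-weight denominators $\pi^{(i)}_\nu,\sigma_\nu$) be of order $p$ and assume $$\frac{y_k^{(i)}}{\pi_k^{(i)}}=1+\mathcal O\bigl(\Delta t^{\max\{p-2,1\}}\bigr),\qquad i=1,\dots,s,\ k=1,\dots,N.$$ Let $\bar{\boldsymbol\sigma}(\theta)=(\bar\sigma_1(\theta),\dots,\bar\sigma_N(\theta))^T$ satisfy $$\bar{\boldsymbol\sigma}(\theta)=\mathrm{NB}^\theta_{p^*-1}\bigl(\tfrac1\gamma,\mathbf y^n\bigr)+\mathcal O(\Delta t^{p^*}).$$ Then the dense output formula $$y^{n+\theta}_k=y^n_k+\Delta t\sum_{j=1}^s\bar b_j(\theta)\sum_{\nu=1}^N\left(p_{k\nu}(\mathbf y^{(j)})\frac{y^{n+\theta}_\nu}{\bar\sigma_\nu(\theta)}-d_{k\nu}(\mathbf y^{(j)})\frac{y^{n+\theta}_k}{\bar\sigma_k(\theta)}\right),\quad k=1,\dots,N,$$ has a convergence rate of order $p$.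
   Context: Production-destruction system (PDS). The autonomous initial value problem is $$y_k'(t)=f_k(\mathbf y(t))=\sum_{\nu=1}^N\bigl(p_{k\nu}(\mathbf y(t))-d_{k\nu}(\mathbf y(t))\bigr),\quad k=1,\dots,N,\quad \mathbf y(0)=\mathbf y^0>\mathbf 0,$$ with $p_{k\nu}(\mathbf y),d_{k\nu}(\mathbf y)\ge0$ for $\mathbf y>\mathbf 0$ (inequalities componentwise). It is positive if $\mathbf y(0)>\mathbf 0$ implies $\mathbf y(t)>\mathbf 0$ for all $t>0$, and conservative if $p_{k\nu}=d_{\nu k}$ for all $k,\nu$. The right-hand side is split as $\mathbf f=\sum_{\nu=1}^N\mathbf f^{[\nu]}$ with $f_k^{[\nu]}=p_{k\nu}$ for $k\ne\nu$ and $f_\nu^{[\nu]}=-\sum_{\mu=1}^N d_{\nu\mu}$ (terms $p_{kk}=d_{kk}$ cancel and may be taken to be zero). Runge--Kutta (RK) dense output. The explicit RK method computes $\mathbf y^{(i)}=\mathbf y^n+\Delta t\sum_{j<i}a_{ij}\mathbf f(\mathbf y^{(j)})$ and $\mathbf y^{n+1}=\mathbf y^n+\Delta t\sum_j b_j\mathbf f(\mathbf y^{(j)})$. A dense output formula for it consists of functions $\bar b_j\colon[0,1]\to\mathbb R$ with $\bar b_j(0)=0$, $\bar b_j(1)=b_j$, defining $\mathbf y^{n+\theta}=\mathbf y^n+\Delta t\sum_j\bar b_j(\theta)\mathbf f(\mathbf y^{(j)})$; it has order $q$ if, for every sufficiently smooth $\mathbf f$ and every $\theta\in[0,1]$, $\mathbf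 y^{n+\theta}=\mathbf y(t^n+\theta\Delta t)+\mathcal O(\Delta t^{q+1})$ whenever the exact solution satisfies $\mathbf y(t^n)=\mathbf y^n$. MPRK scheme. For an explicit $s$-stage RK method with $\mathbf A,\mathbf b,\mathbf c\ge\mathbf 0$, the corresponding modified Patankar--Runge--Kutta (MPRK) scheme is $$y^{(i)}_k=y^n_k+\Delta t\sum_{j=1}^{i-1}a_{ij}\sum_{\nu=1}^N\left(p_{k\nu}(\mathbf y^{(j)})\frac{y^{(i)}_\nu}{\pi^{(i)}_\nu}-d_{k\nu}(\mathbf y^{(j)})\frac{y^{(i)}_k}{\pi^{(i)}_k}\right),\quad i=1,\dots,s,$$ $$y^{n+1}_k=y^n_k+\Delta t\sum_{j=1}^{s}b_j\sum_{\nu=1}^N\left(p_{k\nu}(\mathbf y^{(j)})\frac{y^{n+1}_\nu}{\sigma_\nu}-d_{k\nu}(\mathbf y^{(j)})\frac{y^{n+1}_k}{\sigma_k}\right),\quad k=1,\dots,N,$$ where the Patankar-weight denominators $\pi^{(i)}_\nu,\sigma_\nu$ are positive for any $\Delta t\ge0$ and independent of the corresponding numerators $y^{(i)}_k$ and $y^{n+1}_k$, respectively. It is of order $p$ if $\mathbf y^{n+1}=\mathbf y(t^n+\Delta t)+\mathcal O(\Delta t^{p+1})$ whenever $\mathbf y(t^n)=\mathbf y^n$. In the dense output formula of the claim, the stages $\mathbf y^{(j)}$ are those of the MPRK scheme. Colored trees and truncated NB-series. An $N$-tree is a rooted tree each of whose nodes has one of the colors $\{1,\dots,N\}$ (up to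 color-preserving isomorphism). The order $|\tau|$ is the number of nodes, $NT_q$ is the set of all $N$-trees with $1\le|\tau|\le q$, $NT_0=\emptyset$. The single-node tree of color $\nu$ is $\bullet^{[\nu]}$; a tree with root color $\nu$ and children (components left after removing the root) $\tau_1,\dots,\tau_l$ is $[\tau_1,\dots,\tau_l]^{[\nu]}$. Density: $\gamma(\bullet^{[\nu]})=1$, $\gamma(\tau)=|\tau|\prod_i\gamma(\tau_i)$. Symmetry: $\sigma(\bullet^{[\nu]})=1$, and $\sigma(\tau)=\prod_{i=1}^r m_i!\,\sigma(\tau_i)^{m_i}$ if the distinct children $\tau_1,\dots,\tau_r$ occur with multiplicities $m_1,\dots,m_r$ (the function $\sigma(\tau)$ on trees is not to be confused with the denominators $\sigma_\nu$). Elementary differentials: $\mathcal F(\bullet^{[\nu]})(\mathbf y)=\mathbf f^{[\nu]}(\mathbf y)$, $\mathcal F([\tau_1,\dots,\tau_l]^{[\nu]})(\mathbf y)=D^l\mathbf f^{[\nu]}(\mathbf y)(\mathcal F(\tau_1)(\mathbf y),\dots,\mathcal F(\tau_l)(\mathbf y))$. Then $$\mathrm{NB}^\theta_q(u,\mathbf y)=\mathbf y+\sum_{\tau\in NT_q}\frac{(\theta\Delta t)^{|\tau|}}{\sigma(\tau)}u(\tau)\mathcal F(\tau)(\mathbf y),\qquad \mathrm{NB}^\theta_0(u,\mathbf y)=\mathbf y.$$ Standing assumptions and conventions. $\bar{\boldsymbol\sigma}(\theta)>\mathbf 0$ is a continuous function of $\mathbf y^n$ and the stages. Inner consistency is assumed: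 the weights $\bar b_j(\theta)y^{n+\theta}_\nu/\bar\sigma_\nu(\theta)$ vanish at $\theta=0$ and equal $b_jy^{n+1}_\nu/\sigma_\nu$ at $\theta=1$. All $\mathcal O$-statements are as $\Delta t\to0$, for $\theta\in[0,1]$, and are understood, as usual, locally uniformly in $\mathbf y^n>\mathbf 0$. The dense output formula has convergence rate of order $p$ (is convergent of order $p$) if on every bounded time interval $[0,T]$, with $t^n=n\Delta t$, $\mathbf y^n$ the MPRK approximations started at $\mathbf y^0=\mathbf y(0)$ and $\mathbf y(t)$ the exact solution, one has for $\theta\in[0,1]$ that $\max_{n:\,t^n+\Delta t\le T}\|\mathbf y^{n+\theta}-\mathbf y(t^n+\theta\Delta t)\|=\mathcal O(\Delta t^p)$. *)

(* Defs.v *)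
From HB Require Import structures.
From mathcomp Require Import all_boot all_order all_algebra.
From mathcomp Require Import all_classical all_reals all_analysis.

Set Implicit Arguments.
Unset Strict Implicit.
Unset Printing Implicit Defensive.

Import Order.TTheory GRing.Theory Num.Theory.
Import numFieldNormedType.Exports.

Local Open Scope classical_set_scope.
Local Open Scope ring_scope.

Inductive ctree (N : nat) : Type := CNode of 'I_N & seq (ctree N).

Section ColoredTrees.
Variable N : nat.
Implicit Types (t u : ctree N) (ts : seq (ctree N)).

Lemma ctree_ind_all (P : ctree N -> Prop) :
  (forall c ts, foldr (fun u Q => P u /\ Q) True ts -> P (CNode c ts)) ->
  forall t, P t.
Proof.
move=> IH; fix rec 1; case=> c ts; apply: IH.
elim: ts => [|u ts IHts]; first exact: I.
by split; [exact: rec | exact: IHts].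
Qed.

Fixpoint ctree_enc t : GenTree.tree 'I_N :=
  let: CNode c ts := t in
  GenTree.Node 0 (GenTree.Leaf c :: map ctree_enc ts).

Fixpoint ctree_dec (g : GenTree.tree 'I_N) : option (ctree N) :=
  if g is GenTree.Node _ (GenTree.Leaf c :: gs)
  then Some (CNode c (pmap ctree_dec gs)) else None.

Lemma ctree_encK : pcancel ctree_enc ctree_dec.
Proof.
elim/ctree_ind_all => c ts IH /=; congr (Some (CNode _ _)).
by elim: ts IH => //= t ts IHts [-> /IHts ->].
Qed.

End ColoredTrees.

HB.instance Definition _ N := Countable.copy (ctree N) (pcan_type (@ctree_encK N)).

Section TreeFunctions.
Variable N : nat.
Implicit Types (t u : ctree N) (ts : seq (ctree N)).

(* An N-tree is an isomorphism class of such ordered trees.  It is represented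
   by its unique member whose lists of children are, at every node, sorted for a
   fixed total order on ordered trees. *)
Definition tree_le t u : bool := (pickle t <= pickle u)%N.

Fixpoint is_ntree t : bool :=
  let: CNode _ ts := t in sorted tree_le ts && all is_ntree ts.

Fixpoint tree_order t : nat :=
  let: CNode _ ts := t in (sumn (map tree_order ts)).+1.

Definition NT (q : nat) : set (ctree N) :=
  [set t | is_ntree t /\ (1 <= tree_order t <= q)%N].

Fixpoint tree_density t : nat :=
  let: CNode _ ts := t in
  (tree_order t * foldr muln 1 (map tree_density ts))%N.

(* See tree_symmetryE for the usual form over the distinct children. *)
Fixpoint tree_symmetry t : nat :=
  let: CNode _ ts := t in
  ((\prod_(u <- undup ts) (count_mem u ts)`!) *
   foldr muln 1 (map tree_symmetry ts))%N.

Lemma tree_symmetryE c ts :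
  tree_symmetry (CNode c ts) =
  (\prod_(u <- undup ts)
     ((count_mem u ts)`! * tree_symmetry u ^ count_mem u ts))%N.
Proof.
rewrite /= big_split /=; congr muln.
rewrite foldrE big_map -big_undup_iterop_count /=; exact: eq_bigr.
Qed.

Lemma finite_NT q : finite_set (NT q).
Proof.
have seqs (L : seq (ctree N)) n : exists LL : seq (seq (ctree N)),
    forall ts, (size ts <= n)%N -> {subset ts <= L} -> ts \in LL.
  elim: n => [|n [LL HLL]]; first by exists [:: [::]] => -[].
  exists ([::] :: [seq x :: s | x <- L, s <- LL]) => -[|x ts] //= ts_n tsL.
  rewrite inE; apply/orP; right; apply: allpairs_f.
    by apply: tsL; rewrite mem_head.
  by apply: HLL => // y yts; apply: tsL; rewrite inE yts orbT.
suff [L HL] : exists L : seq (ctree N), forall t, (tree_order t <= q)%N -> t \in L.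
  apply: (@sub_finite_set _ _ [set` L]); last exact: finite_seq.
  by move=> t [_ /andP[_ tq]] /=; exact: HL.
elim: q => [|q [L HL]]; first by exists [::] => -[].
have [LL HLL] := seqs L q.
exists [seq CNode c ts | c <- enum 'I_N, ts <- LL] => -[c ts] /=.
rewrite ltnS => ts_q; apply: allpairs_f; first by rewrite mem_enum.
apply: HLL.
  apply: leq_trans ts_q; elim: ts => //= -[d us] ts IH /=.
  by rewrite addSn ltnS (leq_trans IH) // leq_addl.
move=> u uts; apply: HL; apply: leq_trans ts_q.
by rewrite sumnE big_map (big_rem u uts) /= leq_addr.
Qed.

End TreeFunctions.

Section Analysis.
Variable R : realType.

Definition orthant N : set 'rV[R]_N := [set y | forall k, 0 < y ord0 k].

Fixpoint Cr (V W : normedModType R) (D : set V) (r : nat) (f : V -> W) : Prop :=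
  if r is r'.+1 then
    (forall x, D x -> differentiable f x) /\
    (forall v, Cr D r' (fun x => 'd f x v))
  else forall x, D x -> {for x, continuous f}.

(* D^l f (x) (v_1, ..., v_l), as iterated derivatives along constant vectors. *)
Definition multiD (V W : normedModType R) (f : V -> W) (vs : seq V) : V -> W :=
  foldr (fun v g x => 'D_v g x) f vs.

(* On [a, b] the one-sided derivatives at the end points are not mentioned: for
   a continuous f they follow from the continuity of y. *)
Definition solves N (f : 'rV[R]_N -> 'rV[R]_N) (a b : R) (y : R -> 'rV[R]_N) :=
  forall k,
    {within `[a, b], continuous (fun t => y t ord0 k)} /\
    (forall t, a < t < b ->
       is_derive t 1 (fun t => y t ord0 k) (f (y t) ord0 k)).

(* "e = O(h^q) as h -> 0+, locally uniformly in yn \in D", where E h yn is the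
   set of all values that the error e can take for the data (h, yn). *)
Definition loc_unif_O N (V : normedModType R) (D : set 'rV[R]_N) (q : nat)
    (E : R -> 'rV[R]_N -> set V) :=
  forall K, compact K -> K `<=` D ->
  exists C : R, \forall h \near 0^'+,
    forall yn, K yn -> forall e, E h yn e -> `|e| <= C * h ^+ q.

Record butcher (s : nat) := Butcher {
  rkA : 'M[R]_s;
  rkb : 'I_s -> R;
  rkc : 'I_s -> R }.

Definition rk_explicit s (rk : butcher s) :=
  forall i j : 'I_s, (i <= j)%N -> rkA rk i j = 0.

Definition rk_nonneg s (rk : butcher s) :=
  [/\ forall i j, 0 <= rkA rk i j, forall i, 0 <= rkb rk i
    & forall i, 0 <= rkc rk i].

(* The stages are the rows of a matrix. *)
Definition rk_stages s N (rk : butcher s) (f : 'rV[R]_N -> 'rV[R]_N)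
    (h : R) (yn : 'rV[R]_N) (Y : 'M[R]_(s, N)) :=
  forall i, row i Y =
    yn + h *: \sum_(j < s | (j < i)%N) rkA rk i j *: f (row j Y).

Definition rk_output s N (w : 'I_s -> R) (f : 'rV[R]_N -> 'rV[R]_N)
    (h : R) (yn : 'rV[R]_N) (Y : 'M[R]_(s, N)) : 'rV[R]_N :=
  yn + h *: \sum_(j < s) w j *: f (row j Y).

(* The weights w approximate the solution at tn + theta * h up to O(h^(q+1)),
   for every ODE, in any dimension M, whose right-hand side is C^(q+1) on an open
   set Om. *)
Definition rk_order_at s (rk : butcher s) (w : 'I_s -> R) (theta : R) (q : nat) :=
  forall (M : nat) (Om : set 'rV[R]_M) (f : 'rV[R]_M -> 'rV[R]_M),
  open Om -> Cr Om q.+1 f ->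
  loc_unif_O Om q.+1 (fun h yn (e : 'rV[R]_M) => exists tn u Y,
    [/\ solves f tn (tn + h) u,
        forall t, tn <= t <= tn + h -> Om (u t),
        u tn = yn,
        rk_stages rk f h yn Y
      & e = rk_output w f h yn Y - u (tn + theta * h)]).

Definition rk_order s (rk : butcher s) (p : nat) :=
  rk_order_at rk (rkb rk) 1 p.

Definition is_rk_dense_output s (rk : butcher s) (bbar : 'I_s -> R -> R) :=
  forall j, bbar j 0 = 0 /\ bbar j 1 = rkb rk j.

Definition rk_dense_order s (rk : butcher s) (bbar : 'I_s -> R -> R) (q : nat) :=
  forall theta, 0 <= theta <= 1 -> rk_order_at rk (bbar^~ theta) theta q.

Record pds (N : nat) := Pds {
  prd : 'I_N -> 'I_N -> 'rV[R]_N -> R;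
  dst : 'I_N -> 'I_N -> 'rV[R]_N -> R }.

Section PDS.
Variables (N : nat) (S : pds N).

Definition pds_rhs (y : 'rV[R]_N) : 'rV[R]_N :=
  \row_k \sum_nu (prd S k nu y - dst S k nu y).

Definition pds_nonneg :=
  forall k nu y, orthant y -> 0 <= prd S k nu y /\ 0 <= dst S k nu y.

Definition pds_conservative :=
  forall k nu y, orthant y -> prd S k nu y = dst S nu k y.

(* Positivity presupposes that the solution exists for all times. *)
Definition pds_positive :=
  forall y0, orthant y0 ->
    (exists y, y 0 = y0 /\ forall T, 0 < T -> solves pds_rhs 0 T y) /\
    (forall T y, 0 < T -> solves pds_rhs 0 T y -> y 0 = y0 ->
       forall t, 0 <= t <= T -> orthant (y t)).

Definition pds_Cr (r : nat) :=
  forall k nu, Cr (@orthant N) r (prd S k nu : 'rV[R]_N -> R^o) /\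
               Cr (@orthant N) r (dst S k nu : 'rV[R]_N -> R^o).

(* The term mu = nu is left out since d_(nu nu) cancels with p_(nu nu). *)
Definition fsplit (nu : 'I_N) (y : 'rV[R]_N) : 'rV[R]_N :=
  \row_k (if k == nu then - \sum_(mu | mu != nu) dst S nu mu y
          else prd S k nu y).

Lemma sum_fsplit y : pds_conservative -> orthant y ->
  \sum_nu fsplit nu y = pds_rhs y.
Proof.
move=> cons y0; apply/rowP => k; rewrite summxE mxE.
rewrite [LHS](bigD1 k) //= [RHS](bigD1 k) //= mxE eqxx cons // subrr add0r.
rewrite sumrB addrC; congr (_ - _).
by apply: eq_bigr => nu nuk; rewrite mxE eq_sym (negbTE nuk).
Qed.

Fixpoint elem_diff (t : ctree N) (y : 'rV[R]_N) : 'rV[R]_N :=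
  let: CNode nu ts := t in
  multiD (fsplit nu) (map (fun u => elem_diff u y) ts) y.

Definition NBseries (theta h : R) (q : nat) (u : ctree N -> R) (y : 'rV[R]_N) :
    'rV[R]_N :=
  y + \sum_(t \in @NT N q)
        ((theta * h) ^+ tree_order t / (tree_symmetry t)%:R * u t) *:
        elem_diff t y.

Section MPRK.
Variables (s : nat) (rk : butcher s).

(* The linear system for z; J selects the stages that enter it. *)
Definition patankar_update (J : pred 'I_s) (w : 'I_s -> R) (den : 'rV[R]_N)
    (h : R) (yn : 'rV[R]_N) (Y : 'M[R]_(s, N)) (z : 'rV[R]_N) :=
  forall k, z ord0 k = yn ord0 k + h * \sum_(j < s | J j) w j * \sum_nu
    (prd S k nu (row j Y) * (z ord0 nu / den ord0 nu) -
     dst S k nu (row j Y) * (z ord0 k / den ord0 k)).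

(* The denominators of stage i are functions of h, yn and the stages j < i; those
   of the final update are functions of h, yn and all stages. *)
Definition stage_denominators
    (ppi : 'I_s -> R -> 'rV[R]_N -> 'M[R]_(s, N) -> 'rV[R]_N) :=
  (forall (i : 'I_s) h yn Y Y', (forall j : 'I_s, (j < i)%N -> row j Y = row j Y') ->
     ppi i h yn Y = ppi i h yn Y') /\
  (forall i h yn Y, 0 <= h -> orthant yn -> (forall j, orthant (row j Y)) ->
     orthant (ppi i h yn Y)).

Definition positive_denominators
    (sg : R -> 'rV[R]_N -> 'M[R]_(s, N) -> 'rV[R]_N) :=
  forall h yn Y, 0 <= h -> orthant yn -> (forall j, orthant (row j Y)) ->
    orthant (sg h yn Y).

Definition continuous_denominators
    (sg : R -> 'rV[R]_N -> 'M[R]_(s, N) -> 'rV[R]_N) :=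
  forall h yn Y, 0 <= h -> orthant yn -> (forall j, orthant (row j Y)) ->
    {for (yn, Y), continuous (fun x : 'rV[R]_N * 'M[R]_(s, N) => sg h x.1 x.2)}.

Variable ppi : 'I_s -> R -> 'rV[R]_N -> 'M[R]_(s, N) -> 'rV[R]_N.
Variable sg : R -> 'rV[R]_N -> 'M[R]_(s, N) -> 'rV[R]_N.

Definition mprk_stages (h : R) (yn : 'rV[R]_N) (Y : 'M[R]_(s, N)) :=
  forall i : 'I_s,
    patankar_update (fun j => (j < i)%N) (rkA rk i) (ppi i h yn Y) h yn Y (row i Y).

Definition mprk_step (h : R) (yn : 'rV[R]_N) (Y : 'M[R]_(s, N)) (y1 : 'rV[R]_N) :=
  patankar_update xpredT (rkb rk) (sg h yn Y) h yn Y y1.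

Definition mprk_order (p : nat) :=
  loc_unif_O (@orthant N) p.+1 (fun h yn (e : 'rV[R]_N) => exists tn y Y y1,
    [/\ solves pds_rhs tn (tn + h) y, y tn = yn,
        mprk_stages h yn Y, mprk_step h yn Y y1
      & e = y1 - y (tn + h)]).

Definition stage_weights_order (q : nat) :=
  forall i k, loc_unif_O (@orthant N) q (fun h yn (e : R^o) => exists Y,
    mprk_stages h yn Y /\ e = Y i k / ppi i h yn Y ord0 k - 1).

Variable bbar : 'I_s -> R -> R.
Variable sgbar : R -> R -> 'rV[R]_N -> 'M[R]_(s, N) -> 'rV[R]_N.

Definition mprk_dense (theta h : R) (yn : 'rV[R]_N) (Y : 'M[R]_(s, N))
    (z : 'rV[R]_N) :=
  patankar_update xpredT (bbar^~ theta) (sgbar theta h yn Y) h yn Y z.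

Definition inner_consistent :=
  forall h yn Y y1, 0 < h -> orthant yn ->
  mprk_stages h yn Y -> mprk_step h yn Y y1 ->
  forall z j nu,
    (mprk_dense 0 h yn Y z ->
       bbar j 0 * z ord0 nu / sgbar 0 h yn Y ord0 nu = 0) /\
    (mprk_dense 1 h yn Y z ->
       bbar j 1 * z ord0 nu / sgbar 1 h yn Y ord0 nu =
       rkb rk j * y1 ord0 nu / sg h yn Y ord0 nu).

Definition dense_denominators_NB (q r : nat) :=
  forall theta, 0 <= theta <= 1 ->
  loc_unif_O (@orthant N) r (fun h yn (e : 'rV[R]_N) => exists Y,
    mprk_stages h yn Y /\
    e = sgbar theta h yn Y
        - NBseries theta h q (fun t => 1 / (tree_density t)%:R) yn).

(* For small h the dense output is well defined, and its error is O(h^p). The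
   sequence ys consists of the approximations at the times n * h, and Ys n are the
   stages of the step from n * h to (n + 1) * h. *)
Definition dense_convergence_rate (p : nat) :=
  forall y0 T y, orthant y0 -> 0 < T -> solves pds_rhs 0 T y -> y 0 = y0 ->
  forall theta, 0 <= theta <= 1 ->
  exists C : R, \forall h \near 0^'+,
    forall (ys : nat -> 'rV[R]_N) (Ys : nat -> 'M[R]_(s, N)),
    ys 0%N = y0 ->
    (forall n, n.+1%:R * h <= T ->
       mprk_stages h (ys n) (Ys n) /\ mprk_step h (ys n) (Ys n) (ys n.+1)) ->
    forall n, n.+1%:R * h <= T ->
      (exists z, mprk_dense theta h (ys n) (Ys n) z) /\
      (forall z, mprk_dense theta h (ys n) (Ys n) z ->
         `|z - y (n%:R * h + theta * h)| <= C * h ^+ p).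

End MPRK.
End PDS.
End Analysis.

(* Main.v *)
Require Import Defs.
From mathcomp Require Import all_boot all_order all_algebra.
From mathcomp Require Import all_classical all_reals all_analysis.
From mathcomp Require Import ring lra zify.
Set Implicit Arguments.
Unset Strict Implicit.
Unset Printing Implicit Defensive.
Import Order.TTheory GRing.Theory Num.Theory.
Import numFieldNormedType.Exports.
Local Open Scope classical_set_scope.
Local Open Scope ring_scope.

(** The local error of the dense output is analysed over one step that starts at
yn, uniformly for yn in a box [a, b]^N of positive reals, and compared with the
exact flow u from yn; compactness of the boxes supplies all constants.

The dense output z solves a linear system whose coefficients carry the weights
z_nu / sgbar_nu.  If these were equal to 1, then z would be the vector Z obtained
from the Runge-Kutta dense output formula with the MPRK stages.  Two facts control
the difference.
 - The stage weights are 1 + O(h^m), m = max (p - 2) 1, so the MPRK stages differ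
   from the Runge-Kutta stages by O(h^(m+1)) (stages_close); hence Z differs from
   the Runge-Kutta dense output, and so from the exact solution, by O(h^p).
 - The denominators differ from the exact solution by O(h^(p-1)).  Hence
   sgbar - Z = O(h^(p-1)), and the equation of the system makes z / sgbar - 1 the
   fixed point of a contraction with constant O(h) up to an error O(h^(p-1)).  So
   the weights are 1 + O(h^(p-1)), and the factor h in front of the increment gives
   z - Z = O(h^p) (patankar_close_denominators).
The same contraction shows that the linear system has a trivial kernel, so that z
exists even though the weights bbar may be negative (patankar_update_exists).

That the truncated NB-series with coefficients 1/gamma approximates the flow to the
order of its truncation (nb_exact) is proved without computing derivatives of the
flow: as a polynomial in time, the series has the defect O(h^q) in the differential
equation (nb_defect), and Gronwall's inequality does the rest.  The velocity of the
series is a sum over root colors and over forests of children.  The same sum arises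
from f (y + sum of c_u h^|u| F_u) by expanding in one tree direction after the
other, with one-dimensional Taylor polynomials, in the order in which the canonical
representatives list their children (forest_taylor).  In this way neither the
symmetry of the derivatives nor their multilinearity in the directions enters the
identification of the coefficients: the multinomial factors in the symmetry of a
tree are the factorials of the successive Taylor expansions.

Globally, comparing with the exact flow from each MPRK approximation needs only the
stability of the flow (flow_stable), not of the scheme: consistency of order p gives
convergence of order p at the grid points (mprk_converges), the flow carries this
error over to the times between grid points, and the local error of the dense output
adds O(h^p) once. *)

(** * Boxes of row vectors *)

Section Boxes.
Context {R : realType} {N : nat}.
Implicit Types (v x y : 'rV[R]_N) (a b c : R).

Lemma rV_norm_le v c : 0 <= c -> (forall k, `|v ord0 k| <= c) -> `|v| <= c.
Proof.
move=> c0 vc; rewrite /Num.Def.normr /= mx_normrE; apply: bigmax_le => //= -[i j] _ /=.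
by rewrite (ord1 i).
Qed.

Lemma rV_coord_le v k : `|v ord0 k| <= `|v|.
Proof.
rewrite [leRHS]/Num.Def.normr /= mx_normrE.
exact: (le_bigmax _ (fun ij : 'I_1 * 'I_N => `|v ij.1 ij.2|) (ord0, k)).
Qed.

Definition box a b : set 'rV[R]_N := [set y | forall k, a <= y ord0 k <= b].

Lemma box_compact a b : compact (box a b).
Proof.
rewrite [box a b](_ : _ = [set v : 'rV[R]_N | forall i, `[a, b]%classic (v ord0 i)]).
  by apply: (@rV_compact _ _ (fun=> `[a, b]%classic)) => _; exact: segment_compact.
by apply/seteqP; split => v /= vab k; have := vab k; rewrite in_itv.
Qed.

Lemma box_orthant a b : 0 < a -> box a b `<=` @orthant R N.
Proof. by move=> a0 y yab k; have /andP[/(lt_le_trans a0)] := yab k. Qed.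

Lemma box_near a b e y x : box a b y -> `|x - y| <= e -> box (a - e) (b + e) x.
Proof.
move=> yab xy k; have /andP[ya yb] := yab k.
have := le_trans (rV_coord_le (x - y) k) xy.
rewrite !mxE ler_distl => /andP[h1 h2]; apply/andP; split; lra.
Qed.

Lemma box_sub a b a' b' : a' <= a -> b <= b' -> box a b `<=` box a' b'.
Proof.
move=> aa bb y yab k; have /andP[ya yb] := yab k.
by rewrite (le_trans aa) // (le_trans yb).
Qed.

Lemma box_segment a b x y t : box a b x -> box a b y -> 0 <= t <= 1 ->
  box a b (x + t *: (y - x)).
Proof.
move=> xab yab /andP[t0 t1] k; rewrite !mxE.
have /andP[xa xb] := xab k; have /andP[ya yb] := yab k.
apply/andP; split; nra.
Qed.

Lemma open_orthant : open (@orthant R N).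
Proof.
rewrite openE => y y0.
have H k : nbhs y [set x : 'rV[R]_N | 0 < x ord0 k].
  exact: (@coord_continuous R 1 N ord0 k y _ (lt_nbhsr (y0 k))).
exact: (filter_forall _ H).
Qed.

End Boxes.

(** * Continuously differentiable functions on open sets *)

Section CrCalculus.
Context {R : realType}.
Implicit Types (V W U : normedModType R).

(** Differentials are local: the first-order expansion of f is one of g. *)
Lemma near_eq_diff V W (f g : V -> W) x : (\forall y \near x, f y = g y) ->
  differentiable f x -> differentiable g x /\ 'd f x = 'd g x :> (V -> W).
Proof.
move=> fg df.
have [cf ef] := (diff_locallyP _ _).1 df.
have eg : g \o shift x = cst (g x) + 'd f x +o_ (0 : V) id.
  apply/eqaddoP => e e0; move/eqaddoP : ef => /(_ e e0) => H.
  have fg' : \forall h \near (0 : V), f (h + x) = g (h + x).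
    have := fg; rewrite (near_shift 0 x).
    by apply: filterS => h /=; rewrite subr0 /shift.
  near=> h.
  have Efg : f (h + x) = g (h + x) by near: h.
  have : `|(f \o shift x - (cst (f x) + 'd f x)) h| <= e * `|h| by near: h.
  rewrite (_ : (f \o _ - _) h = (g \o shift x - (cst (g x) + 'd f x)) h) //.
  rewrite -[LHS]/(f (h + x) - (f x + 'd f x h)).
  by rewrite Efg (nbhs_singleton fg).
have E : 'd f x = 'd g x :> (V -> W) by apply/esym/diff_unique.
split; last exact: E.
by apply/diff_locallyP; split; rewrite -E.
Unshelve. all: by end_near. Qed.

(** The class only sees the values on an open set.  Directional derivatives are
identified with differentials, and right-hand sides with their colored parts, only
inside the set, so this is what makes the class stable under them. *)
Lemma Cr_eq V W (D : set V) r (f g : V -> W) : open D ->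
  (forall x, D x -> f x = g x) -> Cr D r f -> Cr D r g.
Proof.
move=> oD; elim: r f g => [|r IH] f g fg /=.
  move=> cf x Dx.
  have fgx : \forall y \near x, f y = g y.
    by have := open_nbhs_nbhs (conj oD Dx); apply: filterS => y; exact: fg.
  rewrite /prop_for /continuous_at -(fg x Dx).
  by apply: cvg_trans (cf x Dx); apply: near_eq_cvg; apply: filterS fgx.
move=> [df Cf].
have H x : D x -> differentiable g x /\ 'd f x = 'd g x :> (V -> W).
  move=> Dx; apply: near_eq_diff; last exact: df.
  by have := open_nbhs_nbhs (conj oD Dx); apply: filterS => y; exact: fg.
split=> [x /H[]//|v]; apply: IH (Cf v) => x /H[_ ->]//.
Qed.

Lemma CrW V W (D : set V) r (f : V -> W) : Cr D r.+1 f -> Cr D r f.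
Proof.
elim: r f => [|r IH] f [df Cf].
  by move=> x Dx; apply: differentiable_continuous; exact: df.
by split => // v; apply: IH; exact: Cf.
Qed.

Lemma Cr_le V W (D : set V) r q (f : V -> W) : (q <= r)%N -> Cr D r f -> Cr D q f.
Proof.
elim: r => [|r IH]; rewrite leq_eqVlt => /predU1P[->//|] //.
by rewrite ltnS => /IH H /CrW.
Qed.

Lemma Cr_derive V W (D : set V) r (f : V -> W) v : open D ->
  Cr D r.+1 f -> Cr D r ('D_v f).
Proof.
move=> oD [df /(_ v)]; apply: Cr_eq => // x Dx.
by rewrite deriveE //; exact: df.
Qed.

Lemma Cr_comp_linear V W U (D : set V) r (f : V -> W) (L : {linear W -> U}) :
  continuous L -> open D -> Cr D r f -> Cr D r (L \o f).
Proof.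
move=> cL oD; elim: r f => [|r IH] f /=.
  by move=> cf x Dx; apply: continuous_comp; [exact: cf|exact: cL].
have dL x : differentiable L x by exact: linear_differentiable.
move=> [df Cf]; split=> [x Dx|v].
  by apply: differentiable_comp => //; exact: df.
have := IH _ (Cf v); apply: Cr_eq => // x Dx /=.
rewrite (diff_comp (df x Dx) (dL (f x))) /=.
by have -> := diff_lin (f x) cL.
Qed.

Lemma Cr_add V W (D : set V) r (f g : V -> W) : open D ->
  Cr D r f -> Cr D r g -> Cr D r (f + g).
Proof.
move=> oD; elim: r f g => [|r IH] f g /=.
  by move=> cf cg x Dx; apply: continuousD; [exact: cf|exact: cg].
move=> [df Cf] [dg Cg]; split=> [x Dx|v].
  by apply: differentiableD; [exact: df|exact: dg].
have := IH _ _ (Cf v) (Cg v); apply: Cr_eq => // x Dx.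
by rewrite diffD; [|exact: df|exact: dg].
Qed.

Lemma Cr_cst V W (D : set V) r (c : W) : Cr D r (cst c : V -> W).
Proof.
elim: r c => [|r IH] c /=; first by move=> x Dx; exact: cst_continuous.
split=> [x _|v]; first exact: differentiable_cst.
rewrite (_ : (fun _ => _) = cst 0); first exact: IH.
by apply/funext => x; rewrite diff_cst.
Qed.

Lemma Cr_sum V W (D : set V) r (I : Type) (s : seq I) (P : pred I)
    (f : I -> V -> W) : open D ->
  (forall i, P i -> Cr D r (f i)) -> Cr D r (fun x => \sum_(i <- s | P i) f i x).
Proof.
move=> oD Cf; elim: s => [|i s IH].
  rewrite (_ : (fun _ => _) = cst 0); first exact: Cr_cst.
  by apply/funext => x; rewrite big_nil.
case Pi: (P i); last first.
  by rewrite (_ : (fun _ => _) = (fun x => \sum_(i <- s | P i) f i x)) //;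
    apply/funext => x; rewrite big_cons Pi.
rewrite (_ : (fun _ => _) = f i + (fun x => \sum_(i <- s | P i) f i x)).
  by apply: Cr_add => //; exact: Cf.
by apply/funext => x; rewrite big_cons Pi.
Qed.

Lemma Cr_scale V W (D : set V) r (f : V -> W) (c : R) : open D ->
  Cr D r f -> Cr D r (fun x => c *: f x).
Proof.
move=> oD; apply: (@Cr_comp_linear _ _ _ _ _ _ ( *:%R c)) => //.
by move=> x; exact: scaler_continuous.
Qed.

Lemma Cr_scalel V W (D : set V) r (f : V -> R^o) (w : W) : open D ->
  Cr D r f -> Cr D r (fun x => (f x : R) *: w).
Proof.
move=> oD; elim: r f => [|r IH] f /=.
  by move=> cf x Dx; apply: continuousZl; exact: cf.
move=> [df Cf]; split=> [x Dx|v].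
  by apply: differentiableZl; exact: df.
have := IH _ (Cf v); apply: Cr_eq => // x Dx.
by rewrite diffZl //; exact: df.
Qed.

Lemma multiD_rcons V W (f : V -> W) vs v : multiD f (rcons vs v) = multiD ('D_v f) vs.
Proof. by rewrite /multiD -cats1 foldr_cat. Qed.

Lemma multiD_cat V W (f : V -> W) us vs :
  multiD f (us ++ vs) = multiD (multiD f vs) us.
Proof. by rewrite /multiD foldr_cat. Qed.

Lemma Cr_multiD V W (D : set V) r (f : V -> W) vs : open D ->
  Cr D (size vs + r) f -> Cr D r (multiD f vs).
Proof.
move=> oD; elim: vs r => [//|v vs IH] r Cf /=.
by apply: Cr_derive => //; apply: IH; rewrite addnS.
Qed.

Lemma near_open V (D : set V) (P : V -> Prop) x : open D -> D x ->
  (forall y, D y -> P y) -> \forall y \near x, P y.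
Proof. by move=> oD Dx DP; apply: filterS DP (open_nbhs_nbhs (conj oD Dx)). Qed.

(** Linearity in the function expresses the innermost direction of an iterated
derivative through the coordinate directions. *)
Lemma multiD_lincomb V W (D : set V) n (c : 'I_n -> R) (g : 'I_n -> V -> W) f vs :
  open D -> (forall i, Cr D (size vs) (g i)) ->
  (forall x, D x -> f x = \sum_i c i *: g i x) ->
  forall x, D x -> multiD f vs x = \sum_i c i *: multiD (g i) vs x.
Proof.
move=> oD; elim: vs => [//|v vs IH] Cg fg x Dx /=.
have Cg' i : Cr D (size vs) (g i) by apply: CrW; exact: Cg.
have dg i : derivable (multiD (g i) vs) x v.
  apply: diff_derivable.
  have : Cr D 1 (multiD (g i) vs) by apply: Cr_multiD => //; rewrite addn1; exact: Cg.
  by case=> + _; exact.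
rewrite (@near_eq_derive _ _ _ _ (\sum_i c i *: multiD (g i) vs)); last first.
  by apply: near_open Dx _ => // y Dy; rewrite IH // fct_sumE; apply: eq_bigr.
rewrite derive_sum; last by move=> i; exact: derivableZ.
by apply: eq_bigr => i _; rewrite deriveZ.
Qed.

End CrCalculus.

(** * Bounds on iterated directional derivatives *)

Section DerivativeBounds.
Context {R : realType} {N : nat}.
Implicit Types (W : normedModType R) (D K : set 'rV[R]_N).

Lemma compact_continuous_bounded W D K (f : 'rV[R]_N -> W) :
  compact K -> K `<=` D -> (forall x, D x -> {for x, continuous f}) ->
  exists2 C, 0 <= C & forall x, K x -> `|f x| <= C.
Proof.
move=> cK KD cf.
have /compact_bounded[M [_ HM]] : compact (f @` K).
  apply: continuous_compact => //; apply: continuous_in_subspaceT => x /set_mem Kx.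
  exact: cf (KD _ Kx).
exists (`|M| + 1); first by rewrite addr_ge0.
move=> x Kx; apply: (HM (`|M| + 1)); last by exists x.
by rewrite ltr_pwDr // ler_norm.
Qed.

(** The directions will be elementary differentials, which move with the base
point, so the bound has to be uniform in them.  Expanding the innermost direction in
coordinates reduces it to finitely many derivatives along constant vectors. *)
Lemma multiD_bound W D K r (f : 'rV[R]_N -> W) :
  open D -> compact K -> K `<=` D -> Cr D r f ->
  exists2 C, 0 <= C & forall vs, size vs = r ->
    forall x, K x -> `|multiD f vs x| <= C * \prod_(v <- vs) `|v|.
Proof.
move=> oD cK KD; elim: r f => [|r IH] f Cf.
  have [C C0 HC] := compact_continuous_bounded cK KD Cf.
  by exists C => // -[]// _ x Kx; rewrite big_nil mulr1; exact: HC.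
pose e k : 'rV[R]_N := delta_mx ord0 k.
have /choice[C HC] k := (exists2P _ _).1 (IH _ (Cr_derive (e k) oD Cf)).
exists (\sum_k C k); first by apply: sumr_ge0 => k _; have [] := HC k.
move=> vs; case/lastP: vs => // vs v; rewrite size_rcons => -[svs] x Kx.
rewrite multiD_rcons.
rewrite (multiD_lincomb (D := D) (c := v ord0) (g := fun k => 'D_(e k) f)) //.
- apply: le_trans (ler_norm_sum _ _ _) _; rewrite mulr_suml; apply: ler_sum => k _.
  have [C0 Ck] := HC k.
  rewrite normrZ -cats1 big_cat big_seq1 /= mulrA mulrC.
  by apply: ler_pM => //; [exact: Ck | exact: rV_coord_le].
- by move=> k; rewrite svs; exact: Cr_derive.
- case: Cf => df _ y Dy; have dfy := df y Dy.
  rewrite deriveE // [in LHS](row_sum_delta v) linear_sum; apply: eq_bigr => k _.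
  by rewrite linearZ deriveE.
- exact: KD.
Qed.

Lemma multiD_bound_le W D K r (f : 'rV[R]_N -> W) M :
  open D -> compact K -> K `<=` D -> Cr D r f -> 0 <= M ->
  exists2 C, 0 <= C & forall vs, (size vs <= r)%N -> (forall v, v \in vs -> `|v| <= M) ->
    forall x, K x -> `|multiD f vs x| <= C.
Proof.
move=> oD cK KD Cf M0.
have /choice[C HC] (i : 'I_r.+1) :=
  (exists2P _ _).1 (multiD_bound oD cK KD (Cr_le (ltnSE (ltn_ord i)) Cf)).
exists (\sum_i C i * M ^+ i).
  by apply: sumr_ge0 => i _; rewrite mulr_ge0 ?exprn_ge0 //; have [] := HC i.
move=> vs svs vM x Kx; pose i : 'I_r.+1 := Ordinal (n := r.+1) (m := size vs) svs.
rewrite (bigD1 i) //= -[leLHS]addr0 lerD //; last first.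
  by apply: sumr_ge0 => j _; rewrite mulr_ge0 ?exprn_ge0 //; have [] := HC j.
have [C0 Ci] := HC i.
apply: le_trans (Ci vs erefl x Kx) _; apply: ler_wpM2l => //=.
elim: vs vM {svs i C0 Ci} => [_|v vs IHv vM]; first by rewrite big_nil expr0.
rewrite big_cons /= exprS ler_pM ?prodr_ge0 //; first by apply: vM; rewrite mem_head.
by apply: IHv => u uvs; apply: vM; rewrite inE uvs orbT.
Qed.

Lemma is_derive_coord (V : normedModType R) m n (M : V -> 'M[R]_(m, n)) (x v : V) dM i j :
  is_derive x v M dM -> is_derive x v (fun t => M t i j) (dM i j).
Proof.
move=> [dv <-]; apply: DeriveDef; first exact: (derivable_mxP _ _ _).1 dv i j.
by rewrite derive_mx // mxE.
Qed.

Lemma is_derive_line W (g : 'rV[R]_N -> W) y v t :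
  differentiable g (y + t *: v) ->
  is_derive t 1 (fun s : R => g (y + s *: v)) ('D_v g (y + t *: v)).
Proof.
move=> dg.
have E : (fun h : R => h^-1 *:
     (((fun s : R => g (y + s *: v)) \o shift t) (h *: 1) - g (y + t *: v))) =
   (fun h : R => h^-1 *: ((g \o shift (y + t *: v)) (h *: v) - g (y + t *: v))).
  apply/funext => h /=; congr (_ *: (g _ - _)).
  by rewrite [h *: 1]mulr1 scalerDl addrCA.
apply: DeriveDef; last by rewrite /derive E.
by rewrite /derivable E; exact: diff_derivable.
Qed.

End DerivativeBounds.

(** * Taylor polynomials along lines *)

Section Taylor.
Context {R : realType}.

Lemma mvt_bound (f df : R -> R) (a b C : R) : a <= b ->
  {within `[a, b], continuous f} ->
  (forall t, a < t < b -> is_derive t 1 f (df t)) ->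
  (forall t, a < t < b -> `|df t| <= C) ->
  `|f b - f a| <= C * (b - a).
Proof.
rewrite le_eqVlt => /predU1P[->|ab] cf fd dfC; first by rewrite !subrr normr0 mulr0.
have fd' t : t \in `]a, b[%R -> is_derive t 1 f (df t) by rewrite in_itv; exact: fd.
have [c + ->] := MVT ab fd' cf; rewrite in_itv /= => cab.
have ba0 : 0 <= b - a by rewrite subr_ge0 ltW.
by rewrite normrM (ger0_norm ba0) ler_wpM2r // dfC.
Qed.

Lemma mvt_bound_derive (f df : R -> R) (a b C : R) : a <= b ->
  (forall t, a <= t <= b -> is_derive t 1 f (df t)) ->
  (forall t, a < t < b -> `|df t| <= C) ->
  `|f b - f a| <= C * (b - a).
Proof.
move=> ab fd dfC; apply: mvt_bound dfC => //.
  apply: derivable_within_continuous => t; rewrite in_itv /= => tab.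
  by have [] := fd t tab.
by move=> t /andP[at_ tb]; apply: fd; rewrite !ltW.
Qed.

Lemma is_derive_monomial (c : R) n (t : R) :
  is_derive t 1 (fun s : R => s ^+ n.+1 * c) (n.+1%:R * t ^+ n * c).
Proof.
have := is_derive_poly (c *: 'X^(n.+1)) t.
rewrite (_ : horner _ = fun s : R => s ^+ n.+1 * c); last first.
  by apply/funext => s; rewrite hornerZ hornerXn mulrC.
by rewrite derivZ derivXn hornerZ hornerMn hornerXn [c * _]mulrC mulr_natl.
Qed.

(** Induction with the mean value theorem: the derivative of the remainder of phi 0
is the remainder of phi 1. *)
Lemma taylor_bound n (phi : nat -> R -> R) (X C : R) : 0 <= X ->
  (forall j t, (j <= n)%N -> 0 <= t <= X -> is_derive t 1 (phi j) (phi j.+1 t)) ->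
  (forall t, 0 <= t <= X -> `|phi n.+1 t| <= C) ->
  `|phi 0%N X - \sum_(k < n.+1) X ^+ k / k`!%:R * phi k 0| <= C * X ^+ n.+1.
Proof.
elim: n phi X => [|n IH] phi X X0 dphi phiC.
  rewrite big_ord1 expr0 fact0 divr1 mul1r.
  rewrite -[X in _ * X ^+ 1]subr0 expr1.
  apply: mvt_bound_derive => //; first by move=> t; exact: dphi.
  by move=> t /andP[t0 tX]; rewrite phiC // !ltW.
have C0 : 0 <= C by apply: le_trans (phiC 0 _); rewrite ?lexx.
pose psi t := phi 0%N t - \sum_(k < n.+2) t ^+ k / k`!%:R * phi k 0.
have psi0 : psi 0 = 0.
  rewrite /psi big_ord_recl expr0 fact0 divr1 mul1r big1 ?addr0 ?subrr // => i _.
  by rewrite expr0n /= !mul0r.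
rewrite -/(psi X) -[psi X]subr0 -psi0 exprSr mulrA -[X in _ * X]subr0.
apply: (@mvt_bound_derive _ (fun t =>
  phi 1%N t - \sum_(k < n.+1) t ^+ k / k`!%:R * phi k.+1 0)) => //.
  move=> t t0X; apply: is_deriveB; first exact: dphi.
  rewrite (_ : (fun s : R => _) = cst (phi 0%N 0) +
     \sum_(k < n.+1) (fun s : R => s ^+ k.+1 * (phi k.+1 0 / k.+1`!%:R))); last first.
    apply/funext => s; rewrite big_ord_recl expr0 fact0 divr1 mul1r fctE fct_sumE.
    by congr (_ + _); apply: eq_bigr => i _; rewrite mulrAC -mulrA.
  rewrite -[X in is_derive _ _ _ X]add0r; apply: is_deriveD.
  apply: is_derive_sum => i; apply: is_derive_eq; first exact: is_derive_monomial.
  rewrite factS natrM invfM; field.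
  by rewrite nat1r !pnatr_eq0 -lt0n fact_gt0.
move=> t /andP[t0 tX].
apply: le_trans (_ : C * t ^+ n.+1 <= _); last first.
  by rewrite ler_wpM2l // lerXn2r // ?nnegrE // ltW.
apply: (IH (fun j => phi j.+1)); first exact: ltW.
  move=> j s jn /andP[s0 st]; apply: dphi => //.
  by rewrite s0 (le_trans st) // ltW.
by move=> s /andP[s0 st]; apply: phiC; rewrite s0 (le_trans st) // ltW.
Qed.

Lemma taylor_line N M (D : set 'rV[R]_N) (g : 'rV[R]_N -> 'rV[R]_M) n y v (X C : R) :
  open D -> Cr D n.+1 g -> 0 <= X ->
  (forall t, 0 <= t <= X -> D (y + t *: v)) ->
  (forall t, 0 <= t <= X -> `|multiD g (nseq n.+1 v) (y + t *: v)| <= C) ->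
  `|g (y + X *: v) - \sum_(k < n.+1) (X ^+ k / k`!%:R) *: multiD g (nseq k v) y|
    <= C * X ^+ n.+1.
Proof.
move=> oD Cg X0 Dt HC.
have C0 : 0 <= C by apply: le_trans (HC 0 _); rewrite ?lexx.
apply: rV_norm_le => [|k]; first by rewrite mulr_ge0 // exprn_ge0.
pose phi j (t : R) := (multiD g (nseq j v) (y + t *: v)) ord0 k.
have := @taylor_bound n phi X C X0.
rewrite !mxE summxE /phi scale0r addr0.
under [in X in _ -> X]eq_bigr do rewrite mxE.
apply.
  move=> j t jn tX; apply: is_derive_coord; apply: is_derive_line.
  have : Cr D 1 (multiD g (nseq j v)).
    by apply: Cr_multiD => //; rewrite size_nseq addn1; exact: Cr_le Cg.
  by case=> + _; apply; exact: Dt.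
by move=> t tX; apply: le_trans (HC t tX); exact: rV_coord_le.
Qed.

Lemma box_lipschitz N M (D : set 'rV[R]_N) a b (f : 'rV[R]_N -> 'rV[R]_M) :
  open D -> box a b `<=` D -> Cr D 1 f ->
  exists2 L, 0 <= L & forall x y, box a b x -> box a b y -> `|f x - f y| <= L * `|x - y|.
Proof.
move=> oD bD Cf.
have [L L0 HL] := multiD_bound oD (@box_compact _ _ a b) bD Cf.
exists L => // x y bx by_.
have bt t : 0 <= t <= 1 -> box a b (y + t *: (x - y)) by exact: box_segment.
have := @taylor_line N M D f 0 y (x - y) 1 (L * `|x - y|) oD Cf ler01.
rewrite big_ord1 expr0 fact0 divr1 !scale1r subrKC expr1 mulr1; apply.
  by move=> t /bt /bD.
by move=> t /bt /(HL [:: x - y] erefl); rewrite big_seq1.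
Qed.

End Taylor.

(** * Trajectories over short times *)

Section ShortTimeFlow.
Context {R : realType} {N : nat}.
Implicit Types (f : 'rV[R]_N -> 'rV[R]_N) (u v du dv : R -> 'rV[R]_N) (a b c d h L M : R).

Definition has_velocity (a b : R) u du := forall k,
  {within `[a, b], continuous (fun t => u t ord0 k)} /\
  (forall t, a < t < b -> is_derive t 1 (fun t => u t ord0 k) (du t ord0 k)).

Lemma velocity_sub (a b a' b' : R) u du : a <= a' -> b' <= b ->
  has_velocity a b u du -> has_velocity a' b' u du.
Proof.
move=> aa bb hu k; have [cu du'] := hu k; split.
  apply: continuous_subspaceW cu => t; rewrite /= !in_itv /= => /andP[t1 t2].
  by rewrite (le_trans aa) //= (le_trans t2).
move=> t /andP[t1 t2]; apply: du'.
by rewrite (le_lt_trans aa) // (lt_le_trans t2).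
Qed.

(** Consecutive steps start at different times, whereas the system is autonomous; the
shift lets each step be studied on an interval that starts at zero. *)
Lemma solves_shift f (c h : R) u :
  solves f c (c + h) u -> solves f 0 h (fun t => u (c + t)).
Proof.
move=> su k; have [cu du] := su k; split.
  apply/subspace_continuousP => t; rewrite /= in_itv /= => /andP[t0 th].
  have ct : `[c, c + h]%classic (c + t) by rewrite /= in_itv /= lerDl t0 lerD2l th.
  have /cvgrPdist_lt H := (subspace_continuousP _ _).1 cu _ ct.
  apply/cvgrPdist_lt => e /H; rewrite !near_withinE => {}H.
  have : \forall s \near t, c <= c + s <= c + h ->
      `|u (c + t) ord0 k - u (c + s) ord0 k| < e.
    have K : (c + s) @[s --> t] --> c + t by apply: cvgD; [exact: cvg_cst|exact: cvg_id].
    have := K _ H; rewrite nbhs_simpl /=; move=> KH; near=> s => cs.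
    have := near KH s; rewrite /= in_itv /=; apply=> //; near: s.
  move=> Hn; near=> s; rewrite /= in_itv /= => /andP[s0 sh].
  have : c <= c + s <= c + h -> `|u (c + t) ord0 k - u (c + s) ord0 k| < e by near: s.
  by apply; rewrite lerDl s0 lerD2l sh.
move=> t /andP[t0 th].
have ct : c < c + t < c + h by rewrite ltrDl t0 ltrD2l th.
have := du _ ct.
have E : (fun s => u (c + s) ord0 k) = (fun s => u s ord0 k) \o shift c.
  by apply/funext => s /=; rewrite addrC.
rewrite E addrC => dut.
have dc : is_derive t 1 (shift c) 1 by exact: is_derive_shift.
by have := is_derive1_comp (g := shift c) dut dc; rewrite mulr1 /= addrC.
Unshelve. all: by end_near. Qed.

Lemma velocity_bound (h C : R) u du : 0 <= h -> 0 <= C -> has_velocity 0 h u du ->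
  (forall t, 0 < t < h -> `|du t| <= C) -> `|u h - u 0| <= C * h.
Proof.
move=> h0 C0 hu duC; apply: rV_norm_le => [|k]; first by rewrite mulr_ge0.
have [cu du'] := hu k; rewrite !mxE -[X in _ * X]subr0.
apply: (mvt_bound h0 cu du') => t th; apply: le_trans (duC t th).
exact: rV_coord_le.
Qed.

(** Leaving the d-neighbourhood of a box takes at least the time d / M, where M
bounds the speed.  The infimum of the times spent outside would otherwise be a time
at which the trajectory is still strictly inside. *)
Lemma flow_stays f (a b d M h : R) u : 0 <= h -> 0 <= M -> M * h < d ->
  (forall y, box (a - d) (b + d) y -> `|f y| <= M) ->
  solves f 0 h u -> box a b (u 0) ->
  forall t, 0 <= t <= h -> box (a - d) (b + d) (u t) /\ `|u t - u 0| <= M * t.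
Proof.
move=> h0 M0 Mhd fM su bu0.
have d0 : 0 < d by apply: le_lt_trans Mhd; rewrite mulr_ge0.
have speed t : 0 <= t <= h ->
    (forall s, 0 <= s < t -> box (a - d) (b + d) (u s)) -> `|u t - u 0| <= M * t.
  move=> /andP[t0 th] bs; apply: (velocity_bound t0 M0 (velocity_sub (lexx 0) th su)).
  by move=> s /andP[s0 st]; apply: fM; apply: bs; rewrite st ltW.
have near_start t : 0 <= t <= h -> `|u t - u 0| <= M * t ->
    forall k, a - d < u t ord0 k < b + d.
  move=> /andP[t0 th] ut k; have := le_trans (rV_coord_le _ k) ut.
  rewrite !mxE ler_distl => /andP[h1 h2]; have /andP[a1 b1] := bu0 k.
  have : M * t <= M * h by rewrite ler_wpM2l.
  by move=> ?; apply/andP; split; lra.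
have inside t : 0 <= t <= h -> box (a - d) (b + d) (u t).
  move=> t0h; apply: contrapT => out.
  (* B collects the times spent outside; inf B itself is still a time inside *)
  pose B := [set s | 0 <= s <= h /\ ~ box (a - d) (b + d) (u s)].
  have Bt : B t by [].
  have hB : has_inf B by split; [exists t | exists 0 => s [/andP[]]].
  have lbB s : B s -> inf B <= s by move=> Bs; apply: ge_inf => //; exact: hB.2.
  have i0 : 0 <= inf B by apply: lb_le_inf; [exists t|move=> s [/andP[]]].
  have ih : inf B <= h by apply: le_trans (lbB _ Bt) _; case/andP: t0h.
  have before s : 0 <= s < inf B -> box (a - d) (b + d) (u s).
    move=> /andP[s0 si]; apply: contrapT => nb.
    have /lbB : B s by split => //; rewrite s0 (le_trans (ltW si)).
    by rewrite leNgt si.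
  have i0h : 0 <= inf B <= h by rewrite i0 ih.
  have ui := near_start _ i0h (speed _ i0h before).
  have : \forall s \near inf B, 0 <= s <= h -> forall k, a - d < u s ord0 k < b + d.
    have Hk k : \forall s \near inf B, 0 <= s <= h -> a - d < u s ord0 k < b + d.
      have ii : `[0, h]%classic (inf B) by rewrite /= in_itv.
      have cu := (subspace_continuousP _ _).1 (su k).1 _ ii.
      have /andP[uk1 uk2] := ui k.
      have := cvgr_gt _ cu _ uk1; have := cvgr_lt _ cu _ uk2.
      rewrite !near_withinE => /(_ _)H1 /(_ _)H2; near=> s => s0h.
      have si : `[0, h]%classic s by rewrite /= in_itv.
      have -> : a - d < u s ord0 k by move: si; near: s; exact: H2.
      by move: si; near: s; exact: H1.
    have HA := filter_forall _ Hk; near=> s => s0h k.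
    by move: k s0h; near: s; exact: HA.
  move=> /nbhs_ballP[e e0 He].
  have [s Bs si] := inf_adherent e0 hB.
  case: (Bs) => s0h; apply => k.
  have /(He s) : ball (inf B) e s.
    by rewrite /ball /= distrC ger0_norm ?subr_ge0 ?lbB // ltrBlDl.
  by move=> /(_ s0h k) /andP[/ltW -> /ltW ->].
move=> t t0h; split; first exact: inside.
apply: speed => // s /andP[s0 st]; apply: inside; case/andP: t0h => _ th.
by rewrite s0 (le_trans (ltW st)).
Unshelve. all: by end_near. Qed.

(** For steps with L h <= 1/2 the exponential of Gronwall's inequality is not needed:
the supremum m of the distance satisfies m <= |u 0 - v 0| + (L m + eps) h. *)
Lemma gronwall_short f (a b L h eps : R) u v dv : 0 <= L -> 0 <= eps -> 0 <= h ->
  L * h <= 1 / 2 ->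
  (forall x y, box a b x -> box a b y -> `|f x - f y| <= L * `|x - y|) ->
  solves f 0 h u -> has_velocity 0 h v dv ->
  (forall t, 0 <= t <= h -> box a b (u t)) ->
  (forall t, 0 <= t <= h -> box a b (v t)) ->
  (forall t, 0 < t < h -> `|dv t - f (v t)| <= eps) ->
  forall t, 0 <= t <= h ->
    `|u t - v t| <= (1 + 2 * (L * h)) * (`|u 0 - v 0| + eps * h).
Proof.
move=> L0 e0 h0 Lh fL su hv bu bv ev.
pose S := [set `|u t - v t| | t in [set t | 0 <= t <= h]].
have S0 : S !=set0 by exists `|u 0 - v 0|; exists 0 => //=; rewrite lexx.
have ubS : has_ubound S.
  exists `|b - a| => _ [t t0h <-]; apply: rV_norm_le => // k; rewrite !mxE.
  have /andP[u1 u2] := bu t t0h k; have /andP[v1 v2] := bv t t0h k.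
  have ab : 0 <= b - a by lra.
  rewrite (ger0_norm ab) ler_distl; apply/andP; split; lra.
have leS t : 0 <= t <= h -> `|u t - v t| <= sup S.
  by move=> t0h; apply: sup_upper_bound => //; exists t.
have sup0 : 0 <= sup S by apply: le_trans (leS 0 _); rewrite ?lexx.
have step t : 0 <= t <= h -> `|u t - v t| <= `|u 0 - v 0| + (L * sup S + eps) * h.
  move=> /andP[t0 th].
  have C0 : 0 <= L * sup S + eps by rewrite addr_ge0 // mulr_ge0.
  have huv : has_velocity 0 t (fun t => u t - v t) (fun t => f (u t) - dv t).
    move=> k; have [cu du] := velocity_sub (lexx 0) th su k.
    have [cv dv'] := velocity_sub (lexx 0) th hv k; split.
      rewrite (_ : (fun _ => _) = (fun s => u s ord0 k) - (fun s => v s ord0 k)).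
        by move=> s; apply: continuousB; [exact: cu|exact: cv].
      by apply/funext => s; rewrite !mxE.
    move=> s s0t.
    rewrite (_ : (fun _ => _) = (fun s => u s ord0 k) - (fun s => v s ord0 k)).
      by rewrite !mxE; apply: is_deriveB; [exact: du|exact: dv'].
    by apply/funext => r; rewrite !mxE.
  have speed s : 0 < s < t -> `|f (u s) - dv s| <= L * sup S + eps.
    move=> /andP[s0 st]; have s0h : 0 <= s <= h by rewrite !ltW // (lt_le_trans st).
    rewrite -[f (u s)](subrK (f (v s))) -addrA; apply: le_trans (ler_normD _ _) _.
    apply: lerD; last by rewrite distrC ev // s0 (lt_le_trans st).
    apply: le_trans (fL _ _ (bu s s0h) (bv s s0h)) _.
    by rewrite ler_wpM2l // leS.
  have := velocity_bound t0 C0 huv speed.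
  have : (L * sup S + eps) * t <= (L * sup S + eps) * h by rewrite ler_wpM2l.
  move=> h1 h2; have := le_trans h2 h1.
  have := ler_normD (u 0 - v 0) (u t - v t - (u 0 - v 0)).
  rewrite subrKC => h3 h4; apply: le_trans h3 _; exact: lerD.
have supS : sup S <= `|u 0 - v 0| + (L * sup S + eps) * h.
  by apply: sup_le_ub => // _ [t t0h <-]; exact: step.
have E0 : 0 <= `|u 0 - v 0| + eps * h by rewrite addr_ge0 // mulr_ge0.
have Lh0 : 0 <= L * h by rewrite mulr_ge0.
move=> t /leS; move/le_trans; apply.
move: supS E0 Lh0 Lh sup0; rewrite mulrDl addrCA mulrAC.
move: (L * h) (`|u 0 - v 0| + eps * h) (sup S) => x e m supS E0 x0 xh m0.
have h1 : 0 <= x * (1 - 2 * x) * m by rewrite !mulr_ge0 //; lra.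
have h2 : 0 <= (1 + 2 * x) * (x * m + e - m) by rewrite mulr_ge0 //; lra.
nra.
Qed.

End ShortTimeFlow.

(** * Forests of colored trees *)

Section Forests.
Variable N : nat.
Local Open Scope nat_scope.
Implicit Types (t u : ctree N) (L f : seq (ctree N)).

Lemma tree_order_gt0 t : (0 < tree_order t)%N.
Proof. by case: t. Qed.

Lemma tree_le_trans : transitive (@tree_le N).
Proof. by move=> u t v; exact: leq_trans. Qed.

Lemma tree_le_anti : antisymmetric (@tree_le N).
Proof. by move=> t u /anti_leq /(pcan_inj pickleK). Qed.

Lemma tree_le_total : total (@tree_le N).
Proof. by move=> t u; exact: leq_total. Qed.

(** Trees are listed from the largest to the smallest, because the largest
children are the innermost derivatives and have to be expanded first. *)
Definition decreasing L := pairwise (fun t u => tree_le u t && (u != t)) L.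

(** All ways to choose multiplicities of the trees of L with total order at most d.
For a decreasing L the chosen trees come out in increasing order, as among the
children of a canonical representative. *)
Fixpoint forests L d : seq (seq (ctree N)) :=
  if L is t :: L' then
    [seq f ++ nseq k t | k <- iota 0 (d %/ tree_order t).+1,
                         f <- forests L' (d - k * tree_order t)]
  else [:: [::]].

Definition forest_order f := sumn (map (@tree_order N) f).

Lemma forest_order_cat f g : forest_order (f ++ g) = (forest_order f + forest_order g)%N.
Proof. by rewrite /forest_order map_cat sumn_cat. Qed.

Lemma forest_order_nseq k t : forest_order (nseq k t) = (k * tree_order t)%N.
Proof. by rewrite /forest_order map_nseq sumn_nseq mulnC. Qed.

Lemma sorted_nseq k t : sorted (@tree_le N) (nseq k t).
Proof. by case: k => //= k; elim: k => //= k ->; rewrite /tree_le leqnn. Qed.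

(** In a sorted forest the copies of the largest available tree form the tail. *)
Lemma sorted_split t L f : decreasing (t :: L) -> sorted (@tree_le N) f ->
  all (mem (t :: L)) f -> f = [seq u <- f | u != t] ++ nseq (count_mem t f) t.
Proof.
move=> /= /andP[/allP tL _] sf /allP fL.
have E : [seq u <- f | u == t] = nseq (count_mem t f) t.
  by have /all_pred1P := filter_all (pred1 t) f; rewrite size_filter.
apply: (sorted_eq tree_le_trans tree_le_anti) => //; last first.
  by rewrite -E perm_sym perm_catC; apply/permPl/perm_filterC.
rewrite (sorted_pairwise tree_le_trans) pairwise_cat.
rewrite -!(sorted_pairwise tree_le_trans) (sorted_filter tree_le_trans) //.
rewrite sorted_nseq !andbT; apply/allrelP => u v.
rewrite mem_filter => /andP[/= ut uf] /nseqP[-> _].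
have := fL u uf; rewrite /= inE => /orP[/eqP ut'|/tL /andP[]//].
by rewrite ut' eqxx in ut.
Qed.

Lemma mem_forests L d f : decreasing L ->
  (f \in forests L d) = [&& sorted (@tree_le N) f, all (mem L) f & (forest_order f <= d)%N].
Proof.
elim: L d f => [|t L IH] d f dL.
  by rewrite /= inE; case: f => [|u f] //=; rewrite andbF.
have t0 := tree_order_gt0 t.
have dL' : decreasing L by case/andP: dL.
apply/allpairsPdep/and3P.
  move=> [k [f' [kd]]]; rewrite mem_iota add0n ltnS leq_divRL //= in kd.
  rewrite IH // => /and3P[sf /allP fL fd] ->.
  have tL u : u \in L -> tree_le u t.
    by case/andP: dL => /allP + _ => /[apply] /andP[].
  split.
  - rewrite (sorted_pairwise tree_le_trans) pairwise_cat.
    rewrite -!(sorted_pairwise tree_le_trans) sf sorted_nseq !andbT.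
    by apply/allrelP => u v /fL /tL + /nseqP[-> _].
  - apply/allP => u; rewrite mem_cat => /orP[/fL|/nseqP[-> _]].
      by rewrite /= inE => ->; rewrite orbT.
    by rewrite /= mem_head.
  - by move: fd; rewrite leq_subRL // addnC forest_order_cat forest_order_nseq.
move=> [sf fL fd]; have E := sorted_split dL sf fL.
have Ed : (forest_order [seq u <- f | u != t] + count_mem t f * tree_order t <= d)%N.
  by move: fd; rewrite {1}E forest_order_cat forest_order_nseq.
have kd : (count_mem t f * tree_order t <= d)%N by apply: leq_trans Ed; exact: leq_addl.
exists (count_mem t f), [seq u <- f | u != t]; split => //.
  by rewrite mem_iota add0n ltnS leq_divRL.
rewrite IH // (sorted_filter tree_le_trans) //=; apply/andP; split.
  apply/allP => u; rewrite mem_filter => /andP[ut uf].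
  by have := allP fL u uf; rewrite /= inE (negbTE ut).
by rewrite leq_subRL // addnC.
Qed.

Lemma forests_uniq L d : decreasing L -> uniq (forests L d).
Proof.
elim: L d => [//|t L IH] d dL.
have dL' : decreasing L by case/andP: dL.
have tL : t \notin L.
  by apply/negP => tL; case/andP: dL => /allP /(_ t tL); rewrite eqxx andbF.
have count0 e f : f \in forests L e -> count_mem t f = 0%N.
  rewrite mem_forests // => /and3P[_ /allP fL _].
  by apply/count_memPn/negP => /fL; rewrite /= (negbTE tL).
apply: allpairs_uniq_dep; first exact: iota_uniq.
  by move=> k _; exact: IH.
move=> x y /allpairsPdep[k [f [_ fk ->]]] /allpairsPdep[l [g [_ gl ->]]] /= E.
have kl : k = l.
  have := congr1 (count_mem t) E.
  by rewrite !count_cat (count0 _ _ fk) (count0 _ _ gl) !count_nseq /= eqxx !mul1n.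
rewrite kl in fk E *; congr existT.
have sz : size f = size g by have := congr1 size E; rewrite !size_cat => /addIn.
by have /eqP := E; rewrite eqseq_cat // => /andP[/eqP].
Qed.

(** Deleting the root of a tree of order at most q + 1 leaves a forest of order at
most q, and the color of the root is arbitrary. *)
Lemma NT_forests L q : decreasing L -> (forall u, u \in L -> is_ntree u) ->
  (forall u, is_ntree u -> (tree_order u <= q)%N -> u \in L) ->
  @NT N q.+1 = [set` [seq CNode c f | c <- enum 'I_N, f <- forests L q]].
Proof.
move=> dL Ln nL; apply/seteqP; split.
  move=> [c f] [/= /andP[sf /allP fn]]; rewrite ltnS => fq.
  apply/allpairsP; exists (c, f); split=> //=; first exact: mem_enum.
  rewrite mem_forests // sf fq andbT /=; apply/allP => u uf; apply: nL; first exact: fn.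
  apply: leq_trans fq; rewrite /forest_order sumnE big_map (big_rem u uf) /=.
  exact: leq_addr.
move=> t /allpairsP[[c f] /= [_ + ->]]; rewrite mem_forests // => /and3P[sf /allP fL fq].
split => //=; rewrite sf; apply/allP => u /fL; exact: Ln.
Qed.

Lemma node_forests_uniq L q : decreasing L ->
  uniq [seq CNode c f | c <- enum 'I_N, f <- forests L q].
Proof.
move=> dL; apply: allpairs_uniq; [exact: enum_uniq|exact: forests_uniq|].
by move=> [c f] [c' f'] _ _ /= [-> ->].
Qed.

Lemma NT_seq q : exists L, [/\ decreasing L, uniq L & @NT N q = [set` L]].
Proof.
have /finite_seqP[s sE] := finite_NT N q.
pose ge t u := @tree_le N u t.
have ge_tr : transitive ge by move=> u t v tu uv; exact: tree_le_trans uv tu.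
pose L := sort ge (undup s).
have uL : uniq L by rewrite sort_uniq undup_uniq.
exists L; split => //.
  have : pairwise ge L.
    rewrite -sorted_pairwise //; apply: sort_sorted => t u; exact: tree_le_total.
  elim: L uL {sE} => //= t L IH /andP[tL uL] /andP[/allP geL pL].
  apply/andP; split; last exact: IH.
  apply/allP => u uL'; have := geL u uL'; rewrite /ge => ->.
  by apply: contraNneq tL => <-.
by rewrite sE; apply/seteqP; split => t /=; rewrite mem_sort mem_undup.
Qed.

(** The coefficient of a multiset of trees in a multinomial Taylor expansion. *)
Definition forest_coef (R : realType) (x : ctree N -> R) f : R :=
  ((\prod_(u <- f) x u) / (\prod_(u <- undup f) (count_mem u f)`!)%N%:R)%R.

(** Absent trees contribute 0! = 1, so the product may run over any larger list. *)
Lemma prod_count_fact L f : uniq L -> {subset f <= L} ->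
  (\prod_(u <- undup f) (count_mem u f)`! = \prod_(u <- L) (count_mem u f)`!)%N.
Proof.
move=> uL fL.
rewrite [RHS](bigID (mem f)) /= [X in (_ * X)%N]big1 ?muln1; last first.
  by move=> u /count_memPn ->.
rewrite -[RHS]big_filter; apply: perm_big; apply: uniq_perm => [||u].
- exact: undup_uniq.
- exact: filter_uniq.
- by rewrite mem_undup mem_filter; apply/idP/andP => [uf|[]//]; split => //; exact: fL.
Qed.

Lemma forest_coef_cat_nseq (R : realType) (x : ctree N -> R) f k t : t \notin f ->
  forest_coef x (f ++ nseq k t) = (x t ^+ k / k`!%:R * forest_coef x f)%R.
Proof.
move=> tf; rewrite /forest_coef big_cat /= big_nseq.
have -> : iter k ( *%R (x t)) 1%R = (x t ^+ k)%R by elim: k => //= k ->; rewrite exprS.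
rewrite (prod_count_fact (L := t :: undup f)); last 2 first.
- by rewrite /= mem_undup tf undup_uniq.
- move=> u; rewrite mem_cat inE mem_undup => /orP[->|/nseqP[-> _]]; first by rewrite orbT.
  by rewrite eqxx.
rewrite big_cons count_cat (count_memPn tf) count_nseq /= eqxx mul1n add0n.
rewrite (eq_big_seq (fun u => (count_mem u f)`!)); last first.
  move=> u; rewrite mem_undup => uf; rewrite count_cat count_nseq /=.
  have -> : (t == u) = false by apply: contraNF tf => /eqP ->.
  by rewrite mul0n addn0.
rewrite natrM invfM [LHS]mulrACA; ring.
Qed.

End Forests.

(** * Taylor expansion along several tree directions *)

Section ForestTaylor.
Context {R : realType} {N : nat}.

(** The error of m successive expansions: each adds its own remainder C, and
propagates the errors of the at most r terms that remain to be expanded. *)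
Definition taylor_const (C r : R) m := iter m (fun b => C + r * b) 0.

Lemma taylor_const_ge0 (C r : R) m : 0 <= C -> 0 <= r -> 0 <= taylor_const C r m.
Proof. by move=> C0 r0; elim: m => //= m IH; rewrite addr_ge0 // mulr_ge0. Qed.

(** Only forests of order at most d are kept, since the direction of a tree u has
size h^|u|.  Expanding in the direction of the largest tree t to the degree d / |t|
leaves, for every power k, an expansion in the other trees to the order d - k |t|.
The directions vs already applied to G record the powers taken before. *)
Lemma forest_taylor (D K : set 'rV[R]_N) (G : 'rV[R]_N -> 'rV[R]_N) r (M C : R)
    (F : ctree N -> 'rV[R]_N) (c : ctree N -> R) (h : R) y L d vs :
  open D -> K `<=` D -> Cr D r G -> 0 <= C -> 0 <= M ->
  (forall vs, (size vs <= r)%N -> (forall v, v \in vs -> `|v| <= M) ->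
     forall z, K z -> `|multiD G vs z| <= C) ->
  (forall u, 0 <= c u <= 1) -> 0 <= h <= 1 ->
  decreasing L -> (forall u, u \in L -> `|F u| <= M) ->
  (forall v, v \in vs -> `|v| <= M) ->
  (forall v, `|v| <= (size L)%:R * (h * M) -> K (y + v)) ->
  (size vs + d.+1 <= r)%N ->
  `|multiD G vs (y + \sum_(u <- L) (c u * h ^+ tree_order u) *: F u) -
    \sum_(f <- forests L d) forest_coef (fun u => c u * h ^+ tree_order u) f *:
       multiD (multiD G vs) (map F f) y|
  <= taylor_const C r%:R (size L) * h ^+ d.+1.
Proof.
move=> oD KD CG C0 M0 GC c01 /andP[h0 h1].
set x := fun u => c u * h ^+ tree_order u.
have x0 u : 0 <= x u by rewrite mulr_ge0 ?exprn_ge0 //; have /andP[] := c01 u.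
have xh u : x u <= h ^+ tree_order u.
  by rewrite -[leRHS]mul1r ler_wpM2r ?exprn_ge0 //; have /andP[] := c01 u.
have xh1 u : x u <= h.
  apply: le_trans (xh u) _; rewrite -[leRHS]expr1; apply: ler_wiXn2l => //.
  exact: tree_order_gt0.
elim: L d vs => [|t L IH] d vs dL FM vM yK sr.
  rewrite /= !big_seq1 big_nil addr0 /forest_coef !big_nil divr1 scale1r subrr.
  by rewrite normr0 mul0r.
have [tL dL'] : t \notin L /\ decreasing L.
  case/andP: dL => /allP H dL; split=> //.
  by apply/negP => /H; rewrite eqxx andbF.
have hM0 : 0 <= h * M by rewrite mulr_ge0.
have FL u : u \in L -> `|F u| <= M by move=> uL; apply: FM; rewrite inE uL orbT.
have Ft : `|F t| <= M by apply: FM; rewrite mem_head.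
have sumL : `|\sum_(u <- L) x u *: F u| <= (size L)%:R * (h * M).
  apply: le_trans (ler_norm_sum _ _ _) _.
  rewrite -sum1_size natr_sum mulr_suml big_seq [leRHS]big_seq; apply: ler_sum => u uL.
  by rewrite mul1r normrZ (ger0_norm (x0 u)) ler_pM // ?FL.
have yK' v : `|v| <= (size L)%:R * (h * M) -> K (y + v).
  move=> /le_trans vL; apply: yK; apply: vL; rewrite ler_wpM2r //= ler_nat.
  exact: leqnSn.
set n := (d %/ tree_order t)%N.
have w0 := tree_order_gt0 t.
have nd : (n <= d)%N by exact: leq_div.
set z := y + \sum_(u <- L) x u *: F u.
have zt s : 0 <= s <= x t -> K (z + s *: F t).
  move=> /andP[s0 sx]; rewrite /z -addrA; apply: yK => /=.
  apply: le_trans (ler_normD _ _) _; rewrite -natr1 mulrDl mul1r lerD // normrZ.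
  by rewrite (ger0_norm s0) ler_pM // (le_trans sx).
have nvs k : (k <= n.+1)%N -> forall v, v \in nseq k (F t) ++ vs -> `|v| <= M.
  by move=> _ v; rewrite mem_cat => /orP[/nseqP[->]//|]; exact: vM.
have snr k : (k <= n.+1)%N -> (size (nseq k (F t) ++ vs) <= r)%N.
  move=> kn; rewrite size_cat size_nseq addnC; apply: leq_trans sr.
  by rewrite leq_add2l; apply: leq_trans kn _.
have Cg : Cr D n.+1 (multiD G vs).
  apply: Cr_multiD => //; apply: Cr_le CG.
  by apply: leq_trans sr; rewrite leq_add2l.
have T1 : `|multiD G vs (z + x t *: F t) -
   \sum_(k < n.+1) (x t ^+ k / k`!%:R) *: multiD (multiD G vs) (nseq k (F t)) z|
   <= C * x t ^+ n.+1.
  apply: (taylor_line oD Cg (x0 t)) => s sx; first exact/KD/zt.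
  rewrite -multiD_cat; apply: GC => //; [exact: snr|exact: nvs|exact: zt].
(* n + 1 copies of t exceed the order d, so the remainder has order d + 1 *)
have xnd : x t ^+ n.+1 <= h ^+ d.+1.
  apply: le_trans (_ : (h ^+ tree_order t) ^+ n.+1 <= _).
    by rewrite lerXn2r ?nnegrE // exprn_ge0.
  by rewrite -exprM; apply: ler_wiXn2l => //; rewrite mulnC ltn_ceil.
have T2 (k : 'I_n.+1) : `|multiD (multiD G vs) (nseq k (F t)) z -
    \sum_(f <- forests L (d - k * tree_order t)) forest_coef x f *:
       multiD (multiD G (nseq k (F t) ++ vs)) (map F f) y|
    <= taylor_const C r%:R (size L) * h ^+ (d - k * tree_order t).+1.
  have kn := ltnSE (ltn_ord k).
  have kd : (k * tree_order t <= d)%N by rewrite -leq_divRL.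
  rewrite -multiD_cat; apply: IH => //; first exact/nvs/leqW.
  rewrite size_cat size_nseq -addnA addnCA; apply: leq_trans sr; rewrite leq_add2l.
  rewrite addnS ltnS -[leqRHS](subnKC kd) leq_add2r.
  by rewrite leq_pmulr.
rewrite big_cons addrCA [X in multiD G vs X]addrC -/z.
have -> : forests (t :: L) d = [seq f ++ nseq k t | k <- iota 0 n.+1,
    f <- forests L (d - k * tree_order t)] by [].
rewrite big_allpairs_dep -[iota 0 n.+1]/(index_iota 0 n.+1) big_mkord.
set S1 := \sum_(k < n.+1) _ in T1.
rewrite -(subrK S1 (multiD G vs _)) -addrA; apply: le_trans (ler_normD _ _) _.
have S12 : `|S1 - \sum_(k < n.+1) \sum_(f <- forests L (d - k * tree_order t))
     forest_coef x (f ++ nseq k t) *: multiD (multiD G vs) (map F (f ++ nseq k t)) y|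
   <= r%:R * taylor_const C r%:R (size L) * h ^+ d.+1.
  rewrite /S1 -sumrB; apply: le_trans (ler_norm_sum _ _ _) _.
  apply: le_trans (_ : \sum_(k < n.+1) taylor_const C r%:R (size L) * h ^+ d.+1 <= _).
    apply: ler_sum => k _.
    have kn := ltnSE (ltn_ord k).
    have kd : (k * tree_order t <= d)%N by rewrite -leq_divRL.
    rewrite (eq_big_seq (fun f => (x t ^+ k / k`!%:R) *: (forest_coef x f *:
       multiD (multiD G (nseq k (F t) ++ vs)) (map F f) y))); last first.
      move=> f; rewrite mem_forests // => /and3P[_ /allP fL _].
      rewrite forest_coef_cat_nseq; last by apply: contra tL; exact: fL.
      by rewrite map_cat map_nseq scalerA !multiD_cat.
    rewrite -scaler_sumr -scalerBr normrZ.
    apply: le_trans (_ : h ^+ (k * tree_order t) * (taylor_const C r%:R (size L) *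
        h ^+ (d - k * tree_order t).+1) <= _).
      rewrite ler_pM // ger0_norm ?divr_ge0 ?exprn_ge0 //.
      rewrite ler_pdivrMr ?ltr0n ?fact_gt0 //.
      apply: le_trans (_ : h ^+ (k * tree_order t) * 1 <= _).
        by rewrite mulr1 mulnC exprM lerXn2r ?nnegrE // exprn_ge0.
      by rewrite ler_wpM2l ?exprn_ge0 // ler1n fact_gt0.
    by rewrite mulrCA -exprD addnS subnKC.
  rewrite sumr_const card_ord -[leRHS]mulrA -[leLHS]mulr_natl ler_wpM2r //.
    by rewrite mulr_ge0 ?exprn_ge0 // taylor_const_ge0.
  rewrite ler_nat; apply: leq_trans sr; rewrite (leq_trans _ (leq_addl _ _)) //.
apply: le_trans (lerD T1 S12) _; rewrite /= mulrDl lerD2r.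
by rewrite ler_wpM2l.
Qed.

End ForestTaylor.

(** * The NB-series of the exact flow *)

Section ExactSeries.
Context {R : realType} {N : nat} (S : pds R N).
Implicit Types (a b h s : R) (y : 'rV[R]_N) (L : seq (ctree N)).

Lemma fsplit_Cr r nu : pds_Cr S r -> Cr (@orthant R N) r (fsplit S nu).
Proof.
move=> CS; have oD := @open_orthant R N.
rewrite (_ : fsplit S nu = (fun y => \sum_k (if k == nu
    then - \sum_(mu | mu != nu) dst S nu mu y else prd S k nu y) *: delta_mx ord0 k));
  last first.
  by apply/funext => y; rewrite [LHS]row_sum_delta; apply: eq_bigr => k _; rewrite mxE.
apply: Cr_sum => // k _; case: eqP => _; last exact: Cr_scalel (CS k nu).1.
apply: (@Cr_scalel _ _ _ _ _ (fun y => - \sum_(mu | mu != nu) dst S nu mu y)) => //.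
rewrite (_ : (fun y => _) =
  (fun y => (-1) *: ((\sum_(mu | mu != nu) dst S nu mu y) : R^o))).
  apply: Cr_scale => //; apply: (@Cr_sum _ _ R^o) => // mu _; exact: (CS nu mu).2.
by apply/funext => y; rewrite scaleN1r.
Qed.

Lemma rhs_Cr r : pds_conservative S -> pds_Cr S r -> Cr (@orthant R N) r (pds_rhs S).
Proof.
move=> cons CS; apply: (Cr_eq (@open_orthant R N) (fun y Dy => sum_fsplit cons Dy)).
by apply: Cr_sum => [|nu _]; [exact: open_orthant | exact: fsplit_Cr].
Qed.

(** Room for the stages and the flow that start in the box [a, b]^N; for a > 0 it still
consists of positive vectors. *)
Definition wide_box a b : set 'rV[R]_N := box (a - a / 2) (b + a / 2).

Lemma wide_box_orthant a b : 0 < a -> wide_box a b `<=` @orthant R N.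
Proof. by move=> a0; apply: box_orthant; lra. Qed.

Lemma sub_wide_box a b : 0 < a -> box a b `<=` wide_box a b.
Proof. by move=> a0; apply: box_sub; lra. Qed.

(** The trees up to order r involve derivatives up to order r - 1 only; a bound on the
children gives one on the tree. *)
Lemma elem_diff_bound r a b t : pds_Cr S r -> 0 < a -> (tree_order t <= r)%N ->
  exists2 M, 0 <= M & forall y, box a b y -> `|elem_diff S t y| <= M.
Proof.
move=> CS a0; elim/ctree_ind_all: t => c ts IH tr.
have sz : (size ts <= r)%N.
  apply: leq_trans tr; rewrite /= leqW //; elim: ts {IH} => //= u ts IH.
  by rewrite -add1n leq_add // tree_order_gt0.
have [C C0 HC] := multiD_bound (@open_orthant R N) (@box_compact R N a b)
  (box_orthant (b := b) a0) (Cr_le sz (fsplit_Cr c CS)).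
have [P P0 HP] : exists2 P, 0 <= P & forall y, box a b y ->
    \prod_(v <- map (fun u => elem_diff S u y) ts) `|v| <= P.
  move: tr; rewrite /=; elim: ts {HC sz} IH => [|u ts IHts] /= IH tr.
    by exists 1 => // y _; rewrite big_nil.
  case: IH => Hu /IHts[|P P0 HP].
    by apply: leq_trans tr; rewrite ltnS leq_addl.
  have [|M M0 HM] := Hu; first by apply: leq_trans tr; rewrite leqW // leq_addr.
  exists (M * P); first exact: mulr_ge0.
  by move=> y yab; rewrite big_cons ler_pM ?HM ?HP // prodr_ge0.
exists (C * P); first exact: mulr_ge0.
move=> y yab /=; apply: le_trans (HC _ _ _ yab) _; first by rewrite size_map.
by rewrite ler_wpM2l // HP.
Qed.

(** The coefficient 1 / (sigma gamma) of the exact solution. *)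
Definition nb_weight (t : ctree N) : R :=
  (tree_symmetry t)%:R^-1 * (tree_density t)%:R^-1.

Definition nb_sum L y s : 'rV[R]_N :=
  y + \sum_(u <- L) (nb_weight u * s ^+ tree_order u) *: elem_diff S u y.

Definition nb_velocity L y s : 'rV[R]_N :=
  \sum_(u <- L) ((tree_order u)%:R * s ^+ (tree_order u).-1 * nb_weight u)
    *: elem_diff S u y.

Lemma nb_weight01 t : 0 <= nb_weight t <= 1.
Proof.
have H n : 0 <= (n%:R^-1 : R) <= 1.
  rewrite invr_ge0 ler0n /=; case: n => [|n]; first by rewrite invr0 ler01.
  by rewrite invf_le1 ?ltr0n // ler1n.
have /andP[h1 h2] := H (tree_symmetry t); have /andP[h3 h4] := H (tree_density t).
by rewrite mulr_ge0 //= mulr_ile1.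
Qed.

Lemma NBseriesE theta h q L y : uniq L -> @NT N q = [set` L] ->
  NBseries S theta h q (fun t => 1 / (tree_density t)%:R) y = nb_sum L y (theta * h).
Proof.
move=> uL LE; rewrite /NBseries LE -fsbig_seq //; congr (_ + _).
apply: eq_bigr => u _; congr (_ *: _).
by rewrite /nb_weight div1r -mulrA mulrC.
Qed.

Lemma nb_has_velocity L y h : has_velocity 0 h (nb_sum L y) (nb_velocity L y).
Proof.
move=> k.
have dnb (t : R) : is_derive t 1 (fun s => nb_sum L y s ord0 k) (nb_velocity L y t ord0 k).
  rewrite /nb_sum /nb_velocity; elim: L => [|u L IH].
    rewrite big_nil mxE (_ : (fun _ => _) = cst (y ord0 k)); first exact: is_derive_cst.
    by apply/funext => s; rewrite big_nil addr0.
  have du := is_derive_monomial (nb_weight u * elem_diff S u y ord0 k) (tree_order u).-1 t.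
  have dL := is_deriveD du IH.
  rewrite [X in is_derive t 1 X _](_ : _ = (fun s : R => s ^+ (tree_order u).-1.+1 *
    (nb_weight u * elem_diff S u y ord0 k)) + (fun s =>
    (y + \sum_(v <- L) (nb_weight v * s ^+ tree_order v) *: elem_diff S v y) ord0 k)).
    refine (is_derive_eq dL _).
    by rewrite big_cons [in RHS]mxE [in RHS]mxE prednK ?tree_order_gt0 // !mulrA.
  apply/funext => s; rewrite big_cons fctE !mxE prednK ?tree_order_gt0 //.
  by rewrite addrCA; congr (_ + _); rewrite mulrCA mulrA.
split; last by move=> t _; exact: dnb.
by apply: derivable_within_continuous => t _; have [] := dnb t.
Qed.

(** The order of the tree in its density cancels against the exponent that comes
down on differentiation; the rest is multiplicative over the children up to the
factorials in the symmetry. *)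
Lemma node_weight c f s :
  (tree_order (CNode c f))%:R * s ^+ (tree_order (CNode c f)).-1 * nb_weight (CNode c f)
  = forest_coef (fun u => nb_weight u * s ^+ tree_order u) f :> R.
Proof.
have -> : (tree_order (CNode c f)).-1 = forest_order f by [].
have E : \prod_(u <- f) (nb_weight u * s ^+ tree_order u) =
    (foldr muln 1%N (map (@tree_symmetry N) f))%:R^-1 *
    (foldr muln 1%N (map (@tree_density N) f))%:R^-1 * s ^+ forest_order f.
  rewrite /forest_order; elim: f => [|u f IH]; first by rewrite big_nil expr0 invr1 !mulr1.
  by rewrite big_cons IH /= !natrM !invfM exprD /nb_weight; ring.
rewrite /forest_coef E /nb_weight.
have -> : tree_density (CNode c f) = (tree_order (CNode c f) *
   foldr muln 1 (map (@tree_density N) f))%N by [].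
have -> : tree_symmetry (CNode c f) = ((\prod_(u <- undup f) (count_mem u f)`!) *
   foldr muln 1 (map (@tree_symmetry N) f))%N by [].
have o0 : (tree_order (CNode c f))%:R != 0 :> R by rewrite pnatr_eq0.
have reorder (o A B D X : R) : o != 0 ->
    o * X * (A * B * (o^-1 * D)) = B * D * X * A by move=> ?; field.
by rewrite !natrM !invfM; exact: reorder.
Qed.

Lemma nb_velocityE q L y s : decreasing L -> uniq L -> @NT N q.+1 = [set` L] ->
  nb_velocity L y s = \sum_c \sum_(f <- forests L q)
    forest_coef (fun u => nb_weight u * s ^+ tree_order u) f *:
      multiD (fsplit S c) (map (fun u => elem_diff S u y) f) y.
Proof.
move=> dL uL LE.
have NTL u : (u \in L) = `[< @NT N q.+1 u >].
  by rewrite LE; apply/idP/asboolP.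
rewrite /nb_velocity (perm_big [seq CNode c f | c <- enum 'I_N, f <- forests L q]) /=.
  rewrite big_allpairs_dep /= big_enum /=; apply: eq_bigr => c _; apply: eq_bigr => f _.
  by rewrite -(node_weight c).
apply: uniq_perm => // [|u]; first exact: node_forests_uniq.
rewrite NTL (@NT_forests N L q) //.
- by apply/asboolP/idP.
- by move=> v; rewrite NTL => /asboolP[].
- move=> v vn vq; rewrite NTL; apply/asboolP; split=> //.
  by rewrite tree_order_gt0 leqW.
Qed.

(** The velocity of the series is exactly the forest expansion of the right-hand side at
the series, summed over the root colors; the defect is the remainder of this expansion. *)
Lemma nb_defect r q a b : pds_conservative S -> pds_Cr S r -> (q <= r)%N -> 0 < a ->
  exists L, [/\ uniq L, @NT N q = [set` L] & exists C h0, [/\ 0 <= C, 0 < h0 &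
    forall y s, box a b y -> 0 <= s <= h0 ->
      wide_box a b (nb_sum L y s) /\
      `|nb_velocity L y s - pds_rhs S (nb_sum L y s)| <= C * s ^+ q]].
Proof.
move=> cons CS qr a0; have [L [dL uL LE]] := NT_seq N q.
exists L; split => //.
have Lq u : u \in L -> (tree_order u <= r)%N.
  move=> uL'; have : @NT N q u by rewrite LE.
  by move=> [_ /andP[_ /leq_trans]]; apply.
have [M M0 HM] : exists2 M, 0 <= M &
    forall y u, box a b y -> u \in L -> `|elem_diff S u y| <= M.
  elim: L Lq {dL uL LE} => [|t L IH] Lr; first by exists 0.
  have [u uL|M M0 HM] := IH; first by apply: Lr; rewrite inE uL orbT.
  have [M1 M10 HM1] := elem_diff_bound b CS a0 (Lr t (mem_head _ _)).
  exists (M1 + M); first exact: addr_ge0.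
  move=> y u yab; rewrite inE => /predU1P[->|uL].
    by apply: le_trans (HM1 y yab) _; rewrite lerDl.
  by apply: le_trans (HM y u yab uL) _; rewrite lerDr.
have kb : compact (wide_box a b) by exact: box_compact.
have /choice[C HC] c := (exists2P _ _).1 (multiD_bound_le (@open_orthant R N) kb
  (wide_box_orthant (b := b) a0) (fsplit_Cr c CS) M0).
have C0 c : 0 <= C c by have [] := HC c.
(* ensures that the sum of the directions stays below a / 2 *)
pose h0 : R := Num.min 1 (a / 2 / ((size L)%:R * M + 1)).
have k0 : 0 < (size L)%:R * M + 1 by rewrite ltr_wpDl // mulr_ge0.
have step s y v : 0 <= s <= h0 -> box a b y -> `|v| <= (size L)%:R * (s * M) ->
    wide_box a b (y + v).
  move=> /andP[s0]; rewrite le_min => /andP[_ sh] yab vs.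
  apply: (box_near yab); rewrite [y + v]addrC addrK; apply: le_trans vs _.
  apply: le_trans (_ : s * ((size L)%:R * M + 1) <= _); last by rewrite -ler_pdivlMr.
  by rewrite mulrCA ler_wpM2l // lerDl.
have w01 := nb_weight01.
have elem0 s u : 0 <= s <= h0 -> 0 <= nb_weight u * s ^+ tree_order u <= s.
  move=> /andP[s0]; rewrite le_min => /andP[s1 _]; have /andP[n0 n1] := w01 u.
  rewrite mulr_ge0 ?exprn_ge0 //= -[leRHS]mul1r ler_pM ?exprn_ge0 //.
  by rewrite -[leRHS]expr1 ler_wiXn2l // tree_order_gt0.
have inside s y : 0 <= s <= h0 -> box a b y -> wide_box a b (nb_sum L y s).
  move=> sh yab; apply: step (sh) (yab) _; have /andP[s0 _] := sh.
  apply: le_trans (ler_norm_sum _ _ _) _.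
  rewrite -sum1_size natr_sum mulr_suml big_seq [leRHS]big_seq; apply: ler_sum => u uL'.
  have /andP[e0 e1] := elem0 s u sh.
  by rewrite mul1r normrZ (ger0_norm e0); apply: ler_pM => //; exact: (HM y u yab uL').
pose q' := q.-1.
(* for q = 0 the series is constant in time, and boundedness suffices *)
exists (\sum_c if q is 0 then C c else taylor_const (C c) r%:R (size L)), h0; split.
- by apply: sumr_ge0 => c _; case: (q) => // _; exact: taylor_const_ge0.
- by rewrite lt_min ltr01 divr_gt0 // divr_gt0.
move=> y s yab sh; split; first exact: inside.
have nbw := inside s y sh yab.
rewrite -(sum_fsplit cons (wide_box_orthant a0 nbw)) mulr_suml.
case: q q' qr LE => [|q] _ qr LE.
  have -> : nb_velocity L y s = 0.
    rewrite /nb_velocity big_seq big1 // => u uL'.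
    have : @NT N 0 u by rewrite LE.
    by move=> [_ /andP[w0 w1]]; rewrite leqNgt w0 in w1.
  rewrite sub0r normrN; apply: le_trans (ler_norm_sum _ _ _) _; apply: ler_sum => c _.
  rewrite expr0 mulr1; have [_ HCc] := HC c.
  exact: (HCc [::]).
rewrite (nb_velocityE y s dL uL LE) -sumrB; apply: le_trans (ler_norm_sum _ _ _) _.
apply: ler_sum => c _; rewrite distrC; have [Cc0 HCc] := HC c.
apply: (forest_taylor (vs := [::]) (@open_orthant R N) (wide_box_orthant (b := b) a0)
  (fsplit_Cr c CS) Cc0 M0 HCc w01) => //.
- by case/andP: sh => ->; rewrite le_min => /andP[].
- by move=> u uL'; exact: HM.
- by move=> v; exact: step.
Qed.

(** A defect of order q in the differential equation over a time h integrates to an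
error of order q + 1. *)
Lemma nb_exact r q a b : pds_conservative S -> pds_Cr S r -> (0 < r)%N -> (q <= r)%N ->
  0 < a ->
  exists C h0, [/\ 0 <= C, 0 < h0 & forall y h u theta, box a b y -> 0 < h <= h0 ->
    solves (pds_rhs S) 0 h u -> u 0 = y -> 0 <= theta <= 1 ->
    `|NBseries S theta h q (fun t => 1 / (tree_density t)%:R) y - u (theta * h)|
      <= C * h ^+ q.+1].
Proof.
move=> cons CS r0 qr a0; have Cf := rhs_Cr cons CS.
have [L [uL LE [C [h1 [C0 h10 HC]]]]] := nb_defect b cons CS qr a0.
have kb : compact (wide_box a b) by exact: box_compact.
have wo := wide_box_orthant (b := b) a0.
have [M M0 HM] := multiD_bound (@open_orthant R N) kb wo (Cr_le (leq0n _) Cf).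
have fM y : wide_box a b y -> `|pds_rhs S y| <= M.
  by move=> wy; have := HM [::] erefl y wy; rewrite big_nil mulr1.
have [K K0 HK] := box_lipschitz (@open_orthant R N) wo (Cr_le r0 Cf).
pose h0 : R := Num.min h1 (Num.min (1 / 2 / (K + 1)) (a / 2 / (M + 1))).
exists (2 * C), h0; split.
- by rewrite mulr_ge0.
- by rewrite !lt_min h10 !divr_gt0 // ltr_wpDl.
move=> y h u theta yab /andP[hp hh] su u0 /andP[t0 t1].
have hn : 0 <= h by exact: ltW.
move: hh; rewrite !le_min => /and3P[hh1 hK hM].
have Mh : M * h < a / 2.
  move: hM; rewrite ler_pdivlMr ?ltr_wpDl // => hM; nra.
have Kh : K * h <= 1 / 2.
  move: hK; rewrite ler_pdivlMr ?ltr_wpDl // => hK; nra.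
have yab' := yab; rewrite -u0 in yab'.
have stay := flow_stays hn M0 Mh fM su yab'.
have th : 0 <= theta * h <= h by rewrite mulr_ge0 //= ler_piMl.
rewrite (NBseriesE theta h y uL LE) distrC.
have eps0 : 0 <= C * h ^+ q by rewrite mulr_ge0 // exprn_ge0.
have := @gronwall_short R N (pds_rhs S) _ _ K h (C * h ^+ q) u (nb_sum L y)
  (nb_velocity L y) K0 eps0 hn Kh HK su (nb_has_velocity L y h).
move=> /(_ (fun t t0h => (stay t t0h).1)) H.
apply: le_trans (H _ _ _ th) _.
- move=> t /andP[t0' th']; apply: (HC y t yab _).1.
  by rewrite t0' (le_trans th').
- move=> t /andP[t0' th']; have [|_ H2] := HC y t yab.
    by rewrite ltW //= (le_trans (ltW th')).
  apply: le_trans H2 _; rewrite ler_wpM2l // lerXn2r ?nnegrE // ltW //.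
- have -> : nb_sum L y 0 = y.
    rewrite /nb_sum big1 ?addr0 // => v _.
    by rewrite expr0n -[tree_order v]prednK ?tree_order_gt0 //= mulr0 scale0r.
  have -> : C * h ^+ q * h = C * h ^+ q.+1 by rewrite exprSr mulrA.
  rewrite u0 subrr normr0 add0r -mulrA.
  apply: ler_wpM2r; first by rewrite mulr_ge0 // exprn_ge0.
  lra.
Qed.

End ExactSeries.

(** * Properties of all small step sizes *)

Section SmallSteps.
Context {R : realType}.

Lemma near_small (c d : R) : 0 < d -> \forall h \near 0^'+, c * h < d.
Proof.
move=> d0; have k0 : 0 < `|c| + 1 by rewrite ltr_wpDl.
apply: filterS (filterI (nbhs_right_gt (0 : R))
  (nbhs_right_lt (x := 0) (divr_gt0 d0 k0))) => h [/= h0].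
rewrite ltr_pdivlMr //; apply: le_lt_trans.
by rewrite mulrC ler_pM2l //; apply: le_trans (ler_norm c) _; rewrite lerDl.
Qed.

Lemma near_step : \forall h \near 0^'+, 0 < h <= (1 : R).
Proof.
by apply: filterS (filterI (nbhs_right_gt (0 : R))
  (nbhs_right_le (x := 0) (@ltr01 R))) => h [/= -> ->].
Qed.

(** The asymptotic hypotheses enter the proof on boxes only. *)
Lemma loc_unif_box N (V : normedModType R) (D : set 'rV[R]_N) q
    (E : R -> 'rV[R]_N -> set V) (a b : R) :
  box a b `<=` D -> loc_unif_O D q E ->
  exists2 C, 0 <= C & \forall h \near 0^'+,
    forall yn, box a b yn -> forall e, E h yn e -> `|e| <= C * h ^+ q.
Proof.
move=> bD /(_ _ (@box_compact R N a b) bD)[C HC]; exists `|C| => //.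
apply: filterS (filterI near_step HC) => h [/andP[h0 _] Hh] yn yab e Ee.
apply: le_trans (Hh _ yab _ Ee) _; rewrite ler_wpM2r ?exprn_ge0 ?ler_norm //.
exact: ltW.
Qed.

End SmallSteps.

(** * Modified Patankar updates *)

Section Patankar.
Context {R : realType} {N s : nat} (S : pds R N).
Variables (J : pred 'I_s) (w : 'I_s -> R) (den : 'rV[R]_N) (h : R) (yn : 'rV[R]_N)
  (Y : 'M[R]_(s, N)) (P W : R).
Hypotheses (h0 : 0 <= h) (P0 : 0 <= P) (W0 : 0 <= W)
  (pP : forall j k nu, J j -> `|prd S k nu (row j Y)| <= P)
  (dP : forall j k nu, J j -> `|dst S k nu (row j Y)| <= P)
  (wW : forall j, `|w j| <= W).

(** The increment of a Patankar update as a linear function of the weights r; for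
r = 1 it is that of the Runge-Kutta method. *)
Definition patankar_lin (r : 'rV[R]_N) k :=
  \sum_(j < s | J j) w j * \sum_nu
    (prd S k nu (row j Y) * r ord0 nu - dst S k nu (row j Y) * r ord0 k).

Definition patankar_const := s%:R * (W * (N%:R * (2 * P))).

Lemma patankar_const_ge0 : 0 <= patankar_const.
Proof. by rewrite /patankar_const !mulr_ge0. Qed.

Lemma patankar_lin_bound r k : `|patankar_lin r k| <= patankar_const * `|r|.
Proof.
apply: le_trans (ler_norm_sum _ _ _) _.
rewrite /patankar_const -[s in s%:R]card_ord -sum1_card natr_sum !mulr_suml.
rewrite [leRHS](bigID J) /= -[leLHS]addr0 lerD //; last first.
  by apply: sumr_ge0 => j _; rewrite mul1r !mulr_ge0.
apply: ler_sum => j Jj; rewrite mul1r normrM -mulrA ler_pM //.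
apply: le_trans (ler_norm_sum _ _ _) _.
rewrite -[N in N%:R]card_ord -sum1_card natr_sum !mulr_suml; apply: ler_sum => nu _.
rewrite mul1r; apply: le_trans (ler_normB _ _) _.
rewrite mulrDl mul1r mulrDl !normrM.
by rewrite lerD // ler_pM ?pP ?dP ?rV_coord_le.
Qed.

(** The increment is linear in the weights, so it moves by at most the constant times
their deviation from one. *)
Lemma patankar_close z rho :
  patankar_update S J w den h yn Y z -> 0 <= rho ->
  (forall nu, `|z ord0 nu / den ord0 nu - 1| <= rho) ->
  `|z - (yn + h *: \sum_(j < s | J j) w j *: pds_rhs S (row j Y))|
    <= h * (patankar_const * rho).
Proof.
move=> Hz rho0 Hrho.
pose r : 'rV[R]_N := \row_nu (z ord0 nu / den ord0 nu - 1).
have rr : `|r| <= rho by apply: rV_norm_le => // nu; rewrite mxE.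
have c0 := patankar_const_ge0.
apply: rV_norm_le => [|k]; first by rewrite !mulr_ge0.
have -> : (z - (yn + h *: \sum_(j < s | J j) w j *: pds_rhs S (row j Y))) ord0 k
    = h * patankar_lin r k.
  rewrite !mxE Hz summxE opprD addrACA subrr add0r -mulrBr -sumrB; congr (_ * _).
  apply: eq_bigr => j Jj; rewrite !mxE -mulrBr -sumrB; congr (_ * _).
  by apply: eq_bigr => nu _; rewrite !mxE; ring.
rewrite normrM (ger0_norm h0) ler_wpM2l //.
apply: le_trans (patankar_lin_bound r k) _.
by rewrite ler_wpM2l.
Qed.

Section Denominators.
Variable delta : R.
Hypotheses (delta0 : 0 < delta) (den_delta : forall nu, delta <= den ord0 nu)
  (hsmall : patankar_const * h <= delta / 2).

Let den_gt0 nu : 0 < den ord0 nu := lt_le_trans delta0 (den_delta nu).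

Lemma ratio_bound (v : 'rV[R]_N) :
  `|\row_nu (v ord0 nu / den ord0 nu)| <= `|v| / delta.
Proof.
apply: rV_norm_le => [|nu]; first by rewrite divr_ge0 // ltW.
rewrite mxE normrM; apply: ler_pM => //; first exact: rV_coord_le.
have d0 := den_gt0 nu.
by rewrite ger0_norm ?invr_ge0 ?(ltW d0) // lef_pV2 ?posrE.
Qed.

(** The deviation r of the weights from one satisfies
delta |r| <= |z - den| <= h Q |r| + err with Q = patankar_const, and
hsmall absorbs the first term on the right. *)
Lemma patankar_close_denominators z err :
  patankar_update S J w den h yn Y z ->
  `|yn + h *: \sum_(j < s | J j) w j *: pds_rhs S (row j Y) - den| <= err ->
  `|z - (yn + h *: \sum_(j < s | J j) w j *: pds_rhs S (row j Y))|
    <= h * (patankar_const * (2 * err / delta)).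
Proof.
move=> Hz Herr.
set X := yn + _ in Herr *.
pose r : 'rV[R]_N := \row_nu ((z - den) ord0 nu / den ord0 nu).
have rE nu : r ord0 nu = z ord0 nu / den ord0 nu - 1.
  by rewrite !mxE mulrBl divff // gt_eqF.
have zX : `|z - X| <= h * (patankar_const * `|r|).
  by apply: patankar_close => // nu; rewrite -rE rV_coord_le.
have rm : `|r| <= (h * (patankar_const * `|r|) + err) / delta.
  apply: le_trans (ratio_bound _) _; rewrite ler_wpM2r ?invr_ge0 ?(ltW delta0) //.
  rewrite -(subrK X z) -addrA; apply: le_trans (ler_normD _ _) _; exact: lerD.
have r2 : `|r| <= 2 * err / delta.
  move: rm; rewrite !ler_pdivlMr // => rm.
  have : `|r| * (patankar_const * h) <= `|r| * (delta / 2) by rewrite ler_wpM2l.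
  lra.
apply: patankar_close => //; first by apply: le_trans r2.
by move=> nu; rewrite -rE; apply: le_trans (rV_coord_le _ _) r2.
Qed.

(** The weights w may be negative, so the matrix need not be an M-matrix; for small h
it is close enough to the identity for its kernel to vanish. *)
Lemma patankar_update_exists : exists z, patankar_update S J w den h yn Y z.
Proof.
pose B : 'M[R]_N := \matrix_(nu, k) \sum_(j < s | J j) w j *
  (prd S k nu (row j Y) / den ord0 nu -
   (nu == k)%:R * \sum_mu dst S k mu (row j Y) / den ord0 k).
have BE (z : 'rV[R]_N) k :
    (z *m B) ord0 k = patankar_lin (\row_nu (z ord0 nu / den ord0 nu)) k.
  rewrite !mxE /patankar_lin.
  under eq_bigr do rewrite mxE mulr_sumr.
  rewrite exchange_big /=; apply: eq_bigr => j _.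
  under eq_bigr do rewrite mulrCA mulrBr.
  rewrite -mulr_sumr; congr (_ * _); rewrite !sumrB; congr (_ - _).
    by apply: eq_bigr => nu _; rewrite !mxE mulrCA.
  rewrite (bigD1 k) //= [X in _ + X]big1 ?addr0; last first.
    by move=> nu /negbTE nuk; rewrite nuk mul0r mulr0.
  by rewrite eqxx mul1r mulr_sumr; apply: eq_bigr => mu _; rewrite !mxE mulrCA.
have uA : 1%:M - h *: B \in unitmx.
  rewrite -row_free_unit; apply/inj_row_free => v /eqP.
  rewrite mulmxBr mulmx1 subr_eq0 -scalemxAr => /eqP vE.
  have : `|v| <= `|v| / 2.
    apply: rV_norm_le => [|k0]; first by rewrite divr_ge0.
    rewrite {1}vE mxE BE normrM (ger0_norm h0).
    apply: le_trans (_ : h * (patankar_const * (`|v| / delta)) <= _).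
      rewrite ler_wpM2l //; apply: le_trans (patankar_lin_bound _ _) _.
      by rewrite ler_wpM2l ?ratio_bound ?patankar_const_ge0.
    rewrite mulrA mulrA ler_pdivrMr // [h * _]mulrC mulrC.
    have : `|v| * (patankar_const * h) <= `|v| * (delta / 2) by rewrite ler_wpM2l.
    by move=> ?; lra.
  have half0 (x : R) : 0 <= x -> x <= x / 2 -> x = 0 by move=> ? ?; lra.
  by move=> v2; apply: normr0_eq0; exact: half0.
exists (yn *m invmx (1%:M - h *: B)) => k; set z := yn *m _.
have : z *m (1%:M - h *: B) = yn by rewrite mulmxKV.
rewrite mulmxBr mulmx1 -scalemxAr => /eqP; rewrite subr_eq => /eqP zE.
rewrite [in LHS]zE mxE [X in _ + X]mxE BE /patankar_lin; congr (_ + _ * _).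
by apply: eq_bigr => j _; congr (_ * _); apply: eq_bigr => nu _; rewrite !mxE.
Qed.

End Denominators.
End Patankar.

(** * Stages of the MPRK scheme *)

Section MPRKAnalysis.
Context {R : realType} {N s : nat} (S : pds R N) (rk : butcher R s).
Implicit Types (a b h : R) (Y X : 'M[R]_(s, N)) (yn : 'rV[R]_N).

Lemma ord_strong_ind (Q : 'I_s -> Prop) :
  (forall i : 'I_s, (forall j : 'I_s, (j < i)%N -> Q j) -> Q i) -> forall i, Q i.
Proof.
move=> H i; have [n] := ubnP (val i).
elim: n i => // n IH i; rewrite ltnS => ni; apply: H => j ji; apply: IH.
exact: leq_trans ji ni.
Qed.

Lemma mx_coord_le m n (A : 'M[R]_(m, n)) i j : `|A i j| <= `|A|.
Proof.
rewrite [leRHS]/Num.Def.normr /= mx_normrE.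
exact: (le_bigmax _ (fun ij : 'I_m * 'I_n => `|A ij.1 ij.2|) (i, j)).
Qed.

Lemma weighted_sum_bound (J : pred 'I_s) (w : 'I_s -> R) (g : 'I_s -> 'rV[R]_N) (W M : R) :
  0 <= W -> 0 <= M -> (forall j, `|w j| <= W) -> (forall j, J j -> `|g j| <= M) ->
  `|\sum_(j < s | J j) w j *: g j| <= s%:R * (W * M).
Proof.
move=> W0 M0 wW gM; apply: le_trans (ler_norm_sum _ _ _) _.
rewrite -[s in s%:R]card_ord -sum1_card natr_sum mulr_suml.
rewrite [leRHS](bigID J) /= -[leLHS]addr0 lerD //; last first.
  by apply: sumr_ge0 => j _; rewrite mul1r mulr_ge0.
by apply: ler_sum => j Jj; rewrite mul1r normrZ ler_pM // gM.
Qed.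

(** The stages are computed one after the other, each from the earlier rows. *)
Lemma rk_stages_exist f h yn : exists X, rk_stages rk f h yn X.
Proof.
suff H n : exists X, forall i : 'I_s, (i < n)%N -> row i X =
    yn + h *: \sum_(j < s | (j < i)%N) rkA rk i j *: f (row j X).
  by have [X HX] := H s; exists X => i; exact: HX.
elim: n => [|n [X HX]]; first by exists 0.
(* fill in row n; the rows from n on do not enter its right-hand side *)
pose X' := \matrix_(i, k) (if (i < n)%N then X i k
  else (yn + h *: \sum_(j < s | (j < i)%N) rkA rk i j *: f (row j X)) ord0 k).
have rX' (i : 'I_s) : (i < n)%N -> row i X' = row i X.
  by move=> ni; apply/rowP => k; rewrite !mxE ni.
exists X' => i; rewrite ltnS => ni.
rewrite [in RHS](eq_bigr (fun j => rkA rk i j *: f (row j X))); last first.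
  by move=> j ji; rewrite rX' // (leq_trans ji).
move: ni; rewrite leq_eqVlt => /predU1P[ni|ni]; last by rewrite rX' // HX.
by apply/rowP => k; rewrite [LHS]mxE mxE ni ltnn.
Qed.

Lemma pds_bounds r a b : pds_conservative S -> pds_Cr S r -> (0 < r)%N -> 0 < a ->
  exists P M K : R, [/\ [/\ 0 <= P, 0 <= M & 0 <= K],
    forall y k nu, wide_box a b y -> `|prd S k nu y| <= P /\ `|dst S k nu y| <= P,
    forall y, wide_box a b y -> `|pds_rhs S y| <= M &
    forall x y, wide_box a b x -> wide_box a b y ->
      `|pds_rhs S x - pds_rhs S y| <= K * `|x - y|].
Proof.
move=> cons CS r0 a0; have Cf := rhs_Cr cons CS.
have kb : compact (wide_box a b : set 'rV[R]_N) by exact: box_compact.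
have wo := @wide_box_orthant R N a b a0.
have [M M0 HM] := compact_continuous_bounded kb wo (Cr_le (leq0n _) Cf).
have [K K0 HK] := box_lipschitz (@open_orthant R N) wo (Cr_le r0 Cf).
have /choice[P HP] (kn : 'I_N * 'I_N) : exists P : R, 0 <= P /\ forall y, wide_box a b y ->
    `|prd S kn.1 kn.2 y| <= P /\ `|dst S kn.1 kn.2 y| <= P.
  have [Cp Cd] := CS kn.1 kn.2.
  have [P1 P10 HP1] := compact_continuous_bounded kb wo (Cr_le (leq0n _) Cp).
  have [P2 P20 HP2] := compact_continuous_bounded kb wo (Cr_le (leq0n _) Cd).
  exists (P1 + P2); split; first exact: addr_ge0.
  move=> y wy; split; first by apply: le_trans (HP1 y wy) _; rewrite lerDl.
  by apply: le_trans (HP2 y wy) _; rewrite lerDr.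
have P0 kn : 0 <= P kn by have [] := HP kn.
have Ple kn : P kn <= \sum_i P i by rewrite (bigD1 kn) //= lerDl sumr_ge0.
exists (\sum_kn P kn), M, K; split => //.
  by split => //; exact: sumr_ge0.
move=> y k nu wy; have [_ /(_ y wy)[h1 h2]] := HP (k, nu).
by split; [apply: le_trans h1 _|apply: le_trans h2 _].
Qed.

Variable ppi : 'I_s -> R -> 'rV[R]_N -> 'M[R]_(s, N) -> 'rV[R]_N.

Lemma stage_weights_eventually a b m : 0 < a -> stage_weights_order S rk ppi m ->
  exists2 C, 0 <= C & \forall h \near 0^'+, forall yn Y, box a b yn ->
    mprk_stages S rk ppi h yn Y ->
    forall i k, `|Y i k / ppi i h yn Y ord0 k - 1| <= C * h ^+ m.
Proof.
move=> a0 Hw.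
have /choice[C HC] (ik : 'I_s * 'I_N) :=
  (exists2P _ _).1 (loc_unif_box (box_orthant (b := b) a0) (Hw ik.1 ik.2)).
have C0 ik : 0 <= C ik by have [] := HC ik.
exists (\sum_ik C ik); first exact: sumr_ge0.
have HA : \forall h \near 0^'+, forall ik yn, box a b yn -> forall e : R^o,
    (exists Y, mprk_stages S rk ppi h yn Y /\
       e = Y ik.1 ik.2 / ppi ik.1 h yn Y ord0 ik.2 - 1) -> `|e| <= C ik * h ^+ m.
  by apply: filter_forall => ik; exact: (HC ik).2.
apply: filterS (filterI near_step HA) => h [/andP[h0 _] Hh] yn Y yab HY i k.
apply: le_trans (Hh (i, k) yn yab _ _) _; first by exists Y.
by rewrite ler_wpM2r ?exprn_ge0 ?(ltW h0) // (bigD1 (i, k)) //= lerDl sumr_ge0.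
Qed.

(** Strong induction on the stage.  With step h K s W <= 1/2 the error of the earlier
stages contributes at most half of the bound, so the same constant 2 Q Cw serves all
stages. *)
Lemma stages_close r a b m : pds_conservative S -> pds_Cr S r -> (0 < r)%N -> 0 < a ->
  stage_weights_order S rk ppi m ->
  exists2 C, 0 <= C & \forall h \near 0^'+, forall yn Y, box a b yn ->
    mprk_stages S rk ppi h yn Y ->
    (forall i, wide_box a b (row i Y)) /\
    forall X, rk_stages rk (pds_rhs S) h yn X ->
      forall i, wide_box a b (row i X) /\ `|row i Y - row i X| <= C * h ^+ m.+1.
Proof.
move=> cons CS r0 a0 Hw.
have [P [M [K [[P0 M0 K0] HP HM HK]]]] := pds_bounds b cons CS r0 a0.
have [Cw Cw0 HCw] := stage_weights_eventually b a0 Hw.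
pose W := `|rkA rk|; have W0 : 0 <= W by exact: normr_ge0.
have wW i j : `|rkA rk i j| <= W by exact: mx_coord_le.
pose Q := @patankar_const R N s P W; have Q0 : 0 <= Q by exact: patankar_const_ge0.
have a2 : 0 < a / 2 by rewrite divr_gt0.
exists (2 * (Q * Cw)); first by rewrite !mulr_ge0.
apply: filterS (filterI near_step (filterI HCw
  (filterI (near_small (Q * Cw + s%:R * (W * M)) a2)
     (near_small (s%:R * (W * K)) (@divr_gt0 R 1 2 ltr01 (ltr0n _ 2)))))).
move=> h [/andP[hp h1] [Hh [ha hK]]] yn Y yab HY.
have h0 : 0 <= h := ltW hp.
have hm1 : h ^+ m <= 1 by rewrite exprn_ile1.
(* shared by the MPRK stages, with an error e, and the Runge-Kutta stages, with e = 0 *)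
have near_yn (i : 'I_s) (Z : 'M[R]_(s, N)) (e : R) :
    (forall j : 'I_s, (j < i)%N -> wide_box a b (row j Z)) ->
    `|row i Z - (yn + h *: \sum_(j < s | (j < i)%N)
        rkA rk i j *: pds_rhs S (row j Z))| <= e ->
    e <= h * (Q * Cw) -> wide_box a b (row i Z).
  move=> wj Hi eh; apply: (box_near yab).
  set G := \sum_(j < s | _) _ in Hi.
  have HG : `|G| <= s%:R * (W * M) by apply: weighted_sum_bound => // j /wj /HM.
  have -> : row i Z - yn = row i Z - (yn + h *: G) + h *: G by rewrite opprD addrA subrK.
  apply: le_trans (ler_normD _ _) _; apply: le_trans (ltW ha).
  rewrite mulrDl [_ * _ * h]mulrC; apply: lerD; first exact: le_trans Hi eh.
  by rewrite normrZ (ger0_norm h0) [leRHS]mulrC ler_wpM2l.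
have closeY (i : 'I_s) : (forall j : 'I_s, (j < i)%N -> wide_box a b (row j Y)) ->
    `|row i Y - (yn + h *: \sum_(j < s | (j < i)%N) rkA rk i j *: pds_rhs S (row j Y))|
      <= h * (Q * (Cw * h ^+ m)).
  move=> wj; apply: (patankar_close h0 P0 W0 _ _ (wW i) (HY i)).
  - by move=> j k nu /wj /(HP _ k nu)[].
  - by move=> j k nu /wj /(HP _ k nu)[].
  - by rewrite mulr_ge0 // exprn_ge0.
  - by move=> nu; rewrite mxE; exact: Hh.
have wideY i : wide_box a b (row i Y).
  elim/ord_strong_ind: i => i IH; apply: (near_yn _ _ _ IH (closeY i IH)).
  by rewrite ler_wpM2l // ler_wpM2l // ler_piMr.
split=> // X HX.
have wideX i : wide_box a b (row i X).
  elim/ord_strong_ind: i => i IH; apply: (near_yn i X 0 IH); last by rewrite !mulr_ge0.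
  by rewrite {1}HX subrr normr0.
move=> i; split => //; elim/ord_strong_ind: i => i IH.
rewrite [row i X]HX.
set GX := \sum_(j < s | _) _; have := closeY i (fun j _ => wideY j).
set GY := \sum_(j < s | _) _ => cY.
have -> : row i Y - (yn + h *: GX) = row i Y - (yn + h *: GY) + h *: (GY - GX).
  by rewrite scalerBr [in RHS]opprD -!addrA [- (h *: GY) + _]addrA addNr add0r opprD.
apply: le_trans (ler_normD _ _) _.
have HG : `|GY - GX| <= s%:R * (W * (K * (2 * (Q * Cw) * h ^+ m.+1))).
  rewrite /GY /GX -sumrB; under eq_bigr do rewrite -scalerBr.
  apply: weighted_sum_bound => //; first by rewrite !mulr_ge0 // exprn_ge0.
  move=> j ji; apply: le_trans (HK _ _ (wideY j) (wideX j)) _.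
  by rewrite ler_wpM2l // IH.
have HG' : `|h *: (GY - GX)| <= Q * Cw * h ^+ m.+1.
  rewrite normrZ (ger0_norm h0).
  apply: le_trans (ler_wpM2l h0 HG) _.
  have e0 : 0 <= 2 * (Q * Cw) * h ^+ m.+1 by rewrite !mulr_ge0 // exprn_ge0.
  have := ler_wpM2r e0 (ltW hK); lra.
apply: le_trans (lerD cY HG') _.
by rewrite exprS le_eqVlt; apply/orP; left; apply/eqP; ring.
Qed.

End MPRKAnalysis.

(** * Local and global errors *)

Section LocalError.
Context {R : realType} {N s : nat} (S : pds R N) (rk : butcher R s).
Implicit Types (a b h : R) (Y X : 'M[R]_(s, N)) (yn : 'rV[R]_N).
Variables (r : nat).
Hypotheses (cons : pds_conservative S) (CS : pds_Cr S r) (r0 : (0 < r)%N)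
  (pos : pds_positive S).

Lemma flow_exists yn : orthant yn ->
  exists2 u, u 0 = yn & forall h, 0 < h -> solves (pds_rhs S) 0 h u /\
    forall t, 0 <= t <= h -> orthant (u t).
Proof.
move=> yn0; have [[u [u0 su]] stay] := pos yn0.
exists u => // h h0; split; first exact: su.
exact: stay h0 (su h h0) u0.
Qed.

Lemma flow_in_wide_box a b : 0 < a ->
  \forall h \near 0^'+, forall u, solves (pds_rhs S) 0 h u -> box a b (u 0) ->
    forall t, 0 <= t <= h -> wide_box a b (u t).
Proof.
move=> a0; have [P [M [K [[_ M0 _] _ HM _]]]] := pds_bounds b cons CS r0 a0.
have a2 : 0 < a / 2 by rewrite divr_gt0.
apply: filterS (filterI near_step (near_small M a2)) => h [/andP[h0 _] Mh] u su bu t th.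
by have [] := flow_stays (ltW h0) M0 Mh HM su bu th.
Qed.

Lemma flow_stable a b : 0 < a ->
  exists2 K, 0 <= K & \forall h \near 0^'+, K * h <= 1 / 2 /\ forall u v,
    solves (pds_rhs S) 0 h u -> solves (pds_rhs S) 0 h v ->
    box a b (u 0) -> (forall t, 0 <= t <= h -> box a b (v t)) ->
    forall t, 0 <= t <= h -> `|u t - v t| <= (1 + 2 * (K * h)) * `|u 0 - v 0|.
Proof.
move=> a0; have [P [M [K [[_ M0 K0] _ _ HK]]]] := pds_bounds b cons CS r0 a0.
exists K => //.
apply: filterS (filterI near_step (filterI (flow_in_wide_box b a0)
  (near_small K (@divr_gt0 R 1 2 ltr01 (ltr0n _ 2))))).
move=> h [/andP[h0 _] [Hf /ltW Kh]]; split=> // u v su sv bu bv t th.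
have := gronwall_short K0 (lexx 0) (ltW h0) Kh HK su sv (Hf u su bu).
rewrite mul0r addr0; apply=> //.
  by move=> x /bv; exact: sub_wide_box.
by move=> x _ /=; rewrite subrr normr0.
Qed.

Lemma nb_exact_eventually a b q : (q <= r)%N -> 0 < a ->
  exists2 C, 0 <= C & \forall h \near 0^'+, forall y u theta, box a b y ->
    solves (pds_rhs S) 0 h u -> u 0 = y -> 0 <= theta <= 1 ->
    `|NBseries S theta h q (fun t => 1 / (tree_density t)%:R) y - u (theta * h)|
      <= C * h ^+ q.+1.
Proof.
move=> qr a0; have [C [h0 [C0 h00 HC]]] := nb_exact b cons CS r0 qr a0.
exists C => //.
apply: filterS (filterI (nbhs_right_gt (0 : R)) (nbhs_right_le (x := 0) h00)).
by move=> h [/= hp hh] y u theta yab; apply: HC => //; rewrite hp.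
Qed.

Variables (p : nat) (bbar : 'I_s -> R -> R).
Variable ppi : 'I_s -> R -> 'rV[R]_N -> 'M[R]_(s, N) -> 'rV[R]_N.
Variable sgbar : R -> R -> 'rV[R]_N -> 'M[R]_(s, N) -> 'rV[R]_N.
Hypotheses (p2 : (2 <= p)%N) (pr : (p <= r)%N).

(** In the chain from z over Z and the Runge-Kutta dense output to the exact solution u,
consecutive members are O(h^p) apart.  The denominators are bounded below by a / 4,
being close to u, so the contraction estimate for the weights applies. *)
Lemma dense_local a b theta : 0 < a -> 0 <= theta <= 1 ->
  rk_dense_order rk bbar p.-1 ->
  stage_weights_order S rk ppi (maxn (p - 2) 1) ->
  dense_denominators_NB S rk ppi sgbar (p.-1 - 1) p.-1 ->
  exists2 C, 0 <= C & \forall h \near 0^'+, forall yn Y, box a b yn ->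
    mprk_stages S rk ppi h yn Y ->
    (exists z, mprk_dense S bbar sgbar theta h yn Y z) /\
    forall z u, mprk_dense S bbar sgbar theta h yn Y z ->
      solves (pds_rhs S) 0 h u -> u 0 = yn ->
      `|z - u (theta * h)| <= C * h ^+ p.
Proof.
move=> a0 th Hrk Hw Hden.
have [qr pq pp p1 pm] : [/\ (p.-1 - 1 <= r)%N, (p.-1 - 1).+1 = p.-1, p.-1.+1 = p,
    (1 <= p.-1)%N & (p <= (maxn (p - 2) 1).+2)%N].
  by clear -p2 pr; split; lia.
have [P [M [K [[P0 M0 K0] HP HM HK]]]] := pds_bounds b cons CS r0 a0.
have [C4 C40 Hst] := stages_close b cons CS r0 a0 Hw.
have bo := @box_orthant R N a b a0.
have [C1 C10 H1] := loc_unif_box bo (Hden theta th).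
have [C2 C20 H2] := nb_exact_eventually b qr a0.
have Cf : Cr (@orthant R N) p.-1.+1 (pds_rhs S).
  by rewrite pp; apply: Cr_le pr _; exact: rhs_Cr.
have [C3 C30 H3] := loc_unif_box bo
  (Hrk theta th N _ _ (@open_orthant R N) Cf).
pose W := \sum_j `|bbar j theta|.
have W0 : 0 <= W by apply: sumr_ge0.
have wW j : `|bbar j theta| <= W by rewrite /W (bigD1 j) //= lerDl sumr_ge0.
pose Q := @patankar_const R N s P W; have Q0 : 0 <= Q by exact: patankar_const_ge0.
pose C5 := s%:R * (W * (K * C4)); have C50 : 0 <= C5 by rewrite !mulr_ge0.
pose C6 := C1 + C2 + C3 + C5; have C60 : 0 <= C6 by rewrite !addr_ge0.
(* the flow stays above a / 2 on the wide box, and the denominators within d of it *)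
pose d := a / 4; have d0 : 0 < d by rewrite divr_gt0.
have d2 : 0 < d / 2 by rewrite divr_gt0.
exists (Q * (2 * C6 / d) + C5 + C3).
  by rewrite !addr_ge0 // !mulr_ge0 // invr_ge0 ltW.
apply: filterS (filterI near_step (filterI (flow_in_wide_box b a0) (filterI Hst
  (filterI H1 (filterI H2 (filterI H3 (filterI (near_small (C1 + C2) d0)
  (near_small Q d2)))))))).
move=> h [/andP[hp h1] [Hflow [{}Hst [{}H1 [{}H2 [{}H3 [hd hQ]]]]]]] yn Y yab HY.
have h0 : 0 <= h := ltW hp.
have [wY Hst'] := Hst yn Y yab HY.
have [X HX] := rk_stages_exist rk (pds_rhs S) h yn.
have wX j : wide_box a b (row j X) by have [] := Hst' X HX j.
have YX j : `|row j Y - row j X| <= C4 * h ^+ (maxn (p - 2) 1).+1.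
  by have [] := Hst' X HX j.
pose den := sgbar theta h yn Y.
pose Z := yn + h *: \sum_(j < s) bbar j theta *: pds_rhs S (row j Y).
have hpow m n : (m <= n)%N -> h ^+ n <= h ^+ m by move=> mn; rewrite ler_wiXn2l.
(* the lower bound on the denominators is needed even before z is known to exist, so
   it is derived from an arbitrary exact solution *)
have main u : solves (pds_rhs S) 0 h u -> u 0 = yn ->
    (forall t, 0 <= t <= h -> orthant (u t)) ->
    [/\ `|den - u (theta * h)| <= (C1 + C2) * h ^+ p.-1,
        `|Z - u (theta * h)| <= (C5 + C3) * h ^+ p & forall nu, d <= den ord0 nu].
  move=> su u0 ou.
  have E1 : `|den - u (theta * h)| <= (C1 + C2) * h ^+ p.-1.
    have n1 := H1 yn yab _ (ex_intro _ Y (conj HY erefl)).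
    have n2 := H2 yn u theta yab su u0 th; rewrite pq in n2.
    rewrite mulrDl; apply: le_trans (lerD n1 n2).
    by apply: le_trans (ler_normD _ _); rewrite addrA subrK.
  have E3 : `|Z - u (theta * h)| <= (C5 + C3) * h ^+ p.
    have n3 : `|rk_output (bbar^~ theta) (pds_rhs S) h yn X - u (0 + theta * h)|
        <= C3 * h ^+ p.-1.+1.
      by apply: (H3 yn yab); exists 0, u, X; rewrite !add0r; split.
    rewrite add0r pp in n3.
    have E5 : `|Z - rk_output (bbar^~ theta) (pds_rhs S) h yn X| <= C5 * h ^+ p.
      rewrite /Z /rk_output opprD addrACA subrr add0r -scalerBr -sumrB.
      rewrite normrZ (ger0_norm h0).
      under eq_bigr do rewrite -scalerBr.
      apply: le_trans (_ : h * (s%:R * (W * (K * (C4 * h ^+ (maxn (p - 2) 1).+1)))) <= _).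
        rewrite ler_wpM2l //; apply: weighted_sum_bound => //.
          by rewrite !mulr_ge0 // exprn_ge0.
        move=> j _; apply: le_trans (HK _ _ (wY j) (wX j)) _; rewrite ler_wpM2l //.
      have -> : h * (s%:R * (W * (K * (C4 * h ^+ (maxn (p - 2) 1).+1)))) =
          C5 * h ^+ (maxn (p - 2) 1).+2 by rewrite /C5 [in RHS]exprS; ring.
      by rewrite ler_wpM2l //; exact: hpow.
    rewrite mulrDl; apply: le_trans (lerD E5 n3).
    by apply: le_trans (ler_normD _ _); rewrite addrA subrK.
  split => // nu.
  have uw : wide_box a b (u (theta * h)).
    apply: Hflow => //; first by rewrite u0.
    by case/andP: th => t0 t1; rewrite mulr_ge0 //= ler_piMl.
  have e1 : `|den - u (theta * h)| <= d.
    apply: le_trans E1 _; apply: le_trans (ltW hd); rewrite ler_wpM2l ?addr_ge0 //.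
    by rewrite -[leRHS]expr1; exact: hpow.
  have := le_trans (rV_coord_le (den - u (theta * h)) nu) e1.
  rewrite !mxE ler_distl => /andP[e2 _].
  by have /andP[e3 _] := uw nu; move: e2 e3; rewrite /d => ? ?; lra.
have [u1 u10 Hu1] := flow_exists (bo _ yab).
have [_ _ den_d] := main u1 (Hu1 h hp).1 u10 (Hu1 h hp).2.
have pP j k nu : xpredT j -> `|prd S k nu (row j Y)| <= P.
  by move=> _; have [] := HP _ k nu (wY j).
have dP j k nu : xpredT j -> `|dst S k nu (row j Y)| <= P.
  by move=> _; have [] := HP _ k nu (wY j).
split.
  exact: (patankar_update_exists yn h0 P0 W0 pP dP wW d0 den_d (ltW hQ)).
move=> z u Hz su u0.
have ou t : 0 <= t <= h -> orthant (u t).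
  have [_ stay] := pos (bo _ yab); exact: stay hp su u0 t.
have [E1 E3 _] := main u su u0 ou.
have ZD : `|Z - den| <= C6 * h ^+ p.-1.
  apply: le_trans (_ : (C5 + C3) * h ^+ p + (C1 + C2) * h ^+ p.-1 <= _).
    rewrite distrC in E1; apply: le_trans (lerD E3 E1).
    by apply: le_trans (ler_normD _ _); rewrite addrA subrK.
  have : (C5 + C3) * h ^+ p <= (C5 + C3) * h ^+ p.-1.
    by rewrite ler_wpM2l ?addr_ge0 //; apply: hpow; exact: leq_pred.
  by rewrite /C6 => ?; lra.
have := patankar_close_denominators h0 P0 W0 pP dP wW d0 den_d (ltW hQ) Hz ZD.
rewrite -/Z -/Q => zZ.
have zZ' : `|z - Z| <= Q * (2 * C6 / d) * h ^+ p.
  by apply: le_trans zZ _; rewrite -pp exprS pp le_eqVlt; apply/orP; left; apply/eqP; ring.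
rewrite -addrA mulrDl; apply: le_trans (lerD zZ' E3).
by apply: le_trans (ler_normD _ _); rewrite addrA subrK.
Qed.

Variable sg : R -> 'rV[R]_N -> 'M[R]_(s, N) -> 'rV[R]_N.

(** Each component attains a positive minimum on the compact time interval. *)
Lemma trajectory_box (T : R) (y : R -> 'rV[R]_N) : 0 <= T ->
  (forall k, {within `[0, T], continuous (fun t => y t ord0 k)}) ->
  (forall t, 0 <= t <= T -> orthant (y t)) ->
  exists a b, 0 < a /\ forall t, 0 <= t <= T -> (box a b : set 'rV[R]_N) (y t).
Proof.
move=> T0 cy oy.
have /choice[c Hc] (k : 'I_N) : exists lh : R * R, 0 < lh.1 /\
    forall t, 0 <= t <= T -> lh.1 <= y t ord0 k <= lh.2.
  have [t1 t1T H1] := EVT_min T0 (cy k); have [t2 t2T H2] := EVT_max T0 (cy k).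
  rewrite in_itv /= in t1T; exists (y t1 ord0 k, y t2 ord0 k); split => /=.
    exact: oy.
  by move=> t tT; rewrite H1 ?H2 ?in_itv.
exists (\big[Num.min/1]_k (c k).1), (\sum_k `|(c k).2|); split.
  by apply: lt_bigmin => // k _; have [] := Hc k.
move=> t tT k; have [_ /(_ t tT)/andP[h1 h2]] := Hc k.
rewrite (le_trans (bigmin_le _ k _) h1) //=; apply: (le_trans h2).
by apply: le_trans (ler_norm _) _; rewrite (bigD1 k) //= lerDl sumr_ge0.
Qed.

(** The error e_n obeys e_(n+1) <= C1 h^(p+1) + (1 + 2 K h) e_n.  The bound so obtained
also keeps the approximations inside the box on which the constants are valid. *)
Lemma mprk_converges y0 (T : R) y : orthant y0 -> 0 < T ->
  solves (pds_rhs S) 0 T y -> y 0 = y0 -> mprk_order S rk ppi sg p ->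
  exists a b C, [/\ 0 < a, 0 <= C, forall t, 0 <= t <= T -> box a b (y t) &
    \forall h \near 0^'+, forall (ys : nat -> 'rV[R]_N) (Ys : nat -> 'M[R]_(s, N)),
    ys 0%N = y0 ->
    (forall n, n.+1%:R * h <= T ->
       mprk_stages S rk ppi h (ys n) (Ys n) /\
       mprk_step S rk sg h (ys n) (Ys n) (ys n.+1)) ->
    forall n, n%:R * h <= T ->
      box a b (ys n) /\ `|ys n - y (n%:R * h)| <= C * h ^+ p].
Proof.
move=> oy0 T0 sy yy0 Hp.
have [_ stay] := pos oy0; have oy := stay T y T0 sy yy0.
have [a' [b' [a'0 Hbox]]] := trajectory_box (ltW T0) (fun k => (sy k).1) oy.
pose a := a' - a' / 2; pose b := b' + a' / 2.
have a0 : 0 < a by rewrite /a; lra.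
have [K K0 Hstab] := flow_stable b a0.
have [C1 C10 Hloc] := loc_unif_box (@box_orthant R N a b a0) Hp.
(* n steps with n h <= T amplify an error by at most (1 + 2 K h)^n <= exp (2 K T) *)
pose C := T * C1 * expR (2 * K * T).
have C0 : 0 <= C by rewrite !mulr_ge0 ?expR_ge0 // ltW.
have yab t : 0 <= t <= T -> box a b (y t) by move=> /Hbox; exact: sub_wide_box.
exists a, b, C; split => //.
have a'2 : 0 < a' / 2 by rewrite divr_gt0.
apply: filterS (filterI near_step (filterI Hstab (filterI Hloc (near_small C a'2)))).
move=> h [/andP[hp h1] [[Kh {}Hstab] [{}Hloc hC]]] ys Ys ys0 Hys.
have h0 : 0 <= h := ltW hp.
pose g := 1 + 2 * (K * h).
have g1 : 1 <= g by rewrite lerDl !mulr_ge0.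
have g0 : 0 <= g by exact: le_trans g1.
have bound n : n%:R * h <= T -> n%:R * (C1 * h ^+ p.+1) * g ^+ n <= C * h ^+ p.
  move=> nT.
  have gn : g ^+ n <= expR (2 * K * T).
    apply: le_trans (_ : expR (2 * (K * h)) ^+ n <= _).
      by rewrite lerXn2r ?nnegrE ?expR_ge0 // expR_ge1Dx.
    rewrite -expRM_natl ler_expR [leLHS](_ : _ = 2 * K * (n%:R * h)); last by ring.
    by rewrite ler_wpM2l // mulr_ge0.
  have -> : n%:R * (C1 * h ^+ p.+1) * g ^+ n = (n%:R * h) * C1 * g ^+ n * h ^+ p.
    by rewrite exprS; ring.
  rewrite ler_wpM2r ?exprn_ge0 // ler_pM ?exprn_ge0 ?mulr_ge0 //.
  by rewrite ler_wpM2r.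
have in_box n : n%:R * h <= T -> `|ys n - y (n%:R * h)| <= C * h ^+ p -> box a b (ys n).
  move=> nT e; apply: (box_near (Hbox (n%:R * h) _)); first by rewrite mulr_ge0.
  apply: le_trans e _; apply: le_trans (ltW hC); rewrite ler_wpM2l //.
  by rewrite -[leRHS]expr1 ler_wiXn2l // ltnW.
suff err n : n%:R * h <= T -> `|ys n - y (n%:R * h)| <= n%:R * (C1 * h ^+ p.+1) * g ^+ n.
  move=> n nT; have e := le_trans (err n nT) (bound n nT).
  by split => //; exact: in_box.
elim: n => [_|n IH nT]; first by rewrite !mul0r ys0 yy0 subrr normr0.
have nE : n.+1%:R * h = n%:R * h + h by rewrite -natr1 mulrDl mul1r.
have nT' : n%:R * h <= T by apply: le_trans nT; rewrite nE lerDl.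
have en := IH nT'; have bn := in_box n nT' (le_trans en (bound n nT')).
have [u u0 Hu] := flow_exists (box_orthant a0 bn); have [su _] := Hu h hp.
have [HY Hstep] := Hys n nT.
have loc : `|ys n.+1 - u (0 + h)| <= C1 * h ^+ p.+1.
  apply: (Hloc (ys n) bn); exists 0, u, (Ys n), (ys n.+1).
  by rewrite add0r; split.
have sv : solves (pds_rhs S) 0 h (fun t => y (n%:R * h + t)).
  apply: solves_shift; apply: velocity_sub sy; first by rewrite mulr_ge0.
  by rewrite -nE.
have hh : 0 <= h <= h by rewrite h0 lexx.
have bu0 : box a b (u 0) by rewrite u0.
have bv t : 0 <= t <= h -> box a b (y (n%:R * h + t)).
  move=> /andP[t0 th]; apply: yab; rewrite addr_ge0 ?mulr_ge0 //=.
  by apply: le_trans nT; rewrite nE lerD2l.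
have := Hstab u _ su sv bu0 bv h hh; rewrite u0 addr0 -nE -/g => stab.
have -> : ys n.+1 - y (n.+1%:R * h) = (ys n.+1 - u (0 + h)) + (u h - y (n.+1%:R * h)).
  by rewrite add0r addrA subrK.
apply: le_trans (ler_normD _ _) _; apply: le_trans (lerD loc stab) _.
have e1 : g * `|ys n - y (n%:R * h)| <= n%:R * (C1 * h ^+ p.+1) * g ^+ n.+1.
  by rewrite [g ^+ n.+1]exprS mulrCA ler_wpM2l.
have e2 : C1 * h ^+ p.+1 <= C1 * h ^+ p.+1 * g ^+ n.+1.
  by rewrite ler_peMr ?exprn_ege1 // mulr_ge0 // exprn_ge0.
have -> : n.+1%:R * (C1 * h ^+ p.+1) * g ^+ n.+1 =
    C1 * h ^+ p.+1 * g ^+ n.+1 + n%:R * (C1 * h ^+ p.+1) * g ^+ n.+1.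
  by rewrite -natr1; ring.
exact: lerD.
Qed.

End LocalError.

Theorem theorem4 (R : realType) (p s N : nat)
    (rk : butcher R s) (bbar : 'I_s -> R -> R) (S : pds R N)
    (ppi : 'I_s -> R -> 'rV[R]_N -> 'M[R]_(s, N) -> 'rV[R]_N)
    (sg : R -> 'rV[R]_N -> 'M[R]_(s, N) -> 'rV[R]_N)
    (sgbar : R -> R -> 'rV[R]_N -> 'M[R]_(s, N) -> 'rV[R]_N) :
  (2 <= p)%N ->
  rk_explicit rk -> rk_nonneg rk -> rk_order rk p ->
  is_rk_dense_output rk bbar -> rk_dense_order rk bbar p.-1 ->
  pds_nonneg S -> pds_positive S -> pds_conservative S -> pds_Cr S p.+1 ->
  stage_denominators ppi -> positive_denominators sg ->
  mprk_order S rk ppi sg p ->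
  stage_weights_order S rk ppi (maxn (p - 2) 1) ->
  (forall theta, 0 <= theta <= 1 ->
     positive_denominators (sgbar theta) /\
     continuous_denominators (sgbar theta)) ->
  inner_consistent S rk ppi sg bbar sgbar ->
  dense_denominators_NB S rk ppi sgbar (p.-1 - 1) p.-1 ->
  dense_convergence_rate S rk ppi sg bbar sgbar p.
Proof.
move=> p2 _ _ _ _ Hrk _ pos cons CS _ _ Hp Hw _ _ Hden.
move=> y0 T y oy0 T0 sy yy0 theta th.
have [a [b [Cg [a0 Cg0 yab Hg]]]] :=
  mprk_converges cons CS (ltn0Sn p) pos p2 oy0 T0 sy yy0 Hp.
have [Cl Cl0 Hl] := dense_local cons CS (ltn0Sn p) pos p2 (leqnSn p) b a0 th Hrk Hw Hden.
have [K K0 Hstab] := flow_stable cons CS (ltn0Sn p) b a0.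
exists (Cl + 2 * Cg).
apply: filterS (filterI near_step (filterI Hg (filterI Hl Hstab))).
move=> h [/andP[hp h1] [{}Hg [{}Hl [Kh {}Hstab]]]] ys Ys ys0 Hys n nT.
have h0 : 0 <= h := ltW hp.
have nE : n.+1%:R * h = n%:R * h + h by rewrite -natr1 mulrDl mul1r.
have nT' : n%:R * h <= T by apply: le_trans nT; rewrite nE lerDl.
have [bn en] := Hg ys Ys ys0 Hys n nT'.
have [HY _] := Hys n nT; have [ex Hz] := Hl (ys n) (Ys n) bn HY.
split => // z Dz.
have [u u0 Hu] := flow_exists pos (box_orthant a0 bn); have [su _] := Hu h hp.
have sv : solves (pds_rhs S) 0 h (fun t => y (n%:R * h + t)).
  apply: solves_shift; apply: velocity_sub sy; first by rewrite mulr_ge0.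
  by rewrite -nE.
have bu0 : box a b (u 0) by rewrite u0.
have bv t : 0 <= t <= h -> box a b (y (n%:R * h + t)).
  move=> /andP[t0 t1]; apply: yab; rewrite addr_ge0 ?mulr_ge0 //=.
  by apply: le_trans nT; rewrite nE lerD2l.
have thh : 0 <= theta * h <= h.
  by case/andP: th => t0 t1; rewrite mulr_ge0 //= ler_piMl.
have := Hstab u _ su sv bu0 bv _ thh; rewrite u0 addr0 => stab.
have dense := Hz z u Dz su u0.
rewrite -(subrKA (u (theta * h))); apply: le_trans (ler_normD _ _) _.
rewrite mulrDl; apply: lerD dense _; apply: le_trans stab _.
rewrite -mulrA; apply: ler_pM en => //; first by rewrite addr_ge0 // !mulr_ge0.
by lra.
Qed.
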